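(* Let $x:T^n=\mathbb{R}^n/\Lambda_n\to\mathbb{S}^{2N-1}$ be a minimal isometric immersion of a flat $n$-torus, where $2N$ is the dimension of the eigenspace of the Laplacian of $T^n$ for the eigenvalue $n$. Then $x$ can be deformed, by a homotopy of minimal isometric immersions of $T^n$ into $\mathbb{S}^{2N-1}$, into a homogeneous minimal isometric immersion whose image lies in a great sphere $\mathbb{S}^p\subset\mathbb{S}^{2N-1}$ with $p<n^2+n$.
   Context: Spheres are unit round spheres. A minimal isometric immersion of a flat $n$-torus into a sphere has coordinate functions that are Laplace eigenfunctions with eigenvalue $n$ (Takahashi). Homogeneity. Choose coordinates so that $T^n=\mathbb{R}^n/\Lambda_n$ ($\Lambda_n$ a lattice of rank $n$) has metric $\frac{4\pi^2}{n}(du_1^2+\cdots+du_n^2)$. Let $\Lambda_n^*=\{\xi:\langle\xi,v\rangle\in\mathbb{Z}\ \forall v\in\Lambda_n\}$ be the dual lattice and let $\pm\xi_1,\dots,\pm\xi_N$ be all vectors of length $1$ in $\Lambda_n^*$. Put $\theta_r=2\pi\langle\xi_r,u\rangle$ and $\Theta_r=(\cos\theta_r,\sin\theta_r)$. Every minimal isometric immersion $x:T^n\to\mathbb{S}^m$ has the form $x=(\Theta_1,\dots,\Theta_N)A$ for a unique real $2N\times(m+1)$ matrix $A$. The immersion $x$ is homogeneous if and only if $AA^t$ is diagonal, equivalently if, up to an isometry of the sphere, $x=(\sqrt{a_1}\,e^{\mathrm{i}\theta_1},\dots,\sqrt{a_N}\,e^{\mathrm{i}\theta_N})$ with $a_r\ge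 0$. *)

(* Defs.v *)
From mathcomp Require Import all_boot all_order all_algebra.
From mathcomp Require Import all_classical all_reals all_analysis.

Set Implicit Arguments.
Unset Strict Implicit.
Unset Printing Implicit Defensive.

Import Order.TTheory GRing.Theory Num.Theory.
Import numFieldNormedType.Exports.

Local Open Scope classical_set_scope.
Local Open Scope ring_scope.

(* Points of R^k are row vectors.  The library's norm on 'rV[R]_k is the sup
   norm (it only serves for topology and differentiation), so the Euclidean
   inner product is introduced separately. *)
Definition dot (R : realType) (k : nat) (v w : 'rV[R]_k) : R :=
  \sum_(i < k) v 0 i * w 0 i.

(* The unit sphere S^(k-1) of R^k. *)
Definition sphere (R : realType) (k : nat) : set 'rV[R]_k :=
  [set y | dot y y = 1].

(* A great sphere S^p: the trace on the sphere of the (p+1)-dimensional linear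
   subspace spanned by the rows of V. *)
Definition is_great_sphere (R : realType) (k p : nat) (C : set 'rV[R]_k) : Prop :=
  exists V : 'M[R]_(p.+1, k),
    row_free V /\ C = [set y | sphere y /\ (y <= V)%MS].

Definition is_lattice (R : realType) (n : nat) (L : set 'rV[R]_n) : Prop :=
  exists B : 'M[R]_n,
    B \in unitmx /\
    L = [set v | exists z : 'rV[int]_n, v = map_mx (fun m : int => m%:~R) z *m B].

(* Functions on the torus R^n/L are L-periodic functions on R^n. *)
Definition periodic (R : realType) (n : nat) (T : Type) (L : set 'rV[R]_n)
    (f : 'rV[R]_n -> T) : Prop :=
  forall u v, L v -> f (u + v) = f u.

Definition partial (R : realType) (n : nat) (V : normedModType R) (i : 'I_n)
    (f : 'rV[R]_n -> V) : 'rV[R]_n -> V :=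
  fun u => 'D_(delta_mx 0 i) f u.

(* C^infinity: every iterated partial derivative is (Frechet) differentiable
   everywhere. *)
Definition smooth (R : realType) (n : nat) (V : normedModType R)
    (f : 'rV[R]_n -> V) : Prop :=
  forall (s : seq 'I_n) (u : 'rV[R]_n),
    differentiable (foldr (fun i g => partial i g) f s) u.

(* The metric of the torus is [metric_coef R n] times du_1^2 + ... + du_n^2. *)
Definition metric_coef (R : realType) (n : nat) : R := 4 * pi ^+ 2 / n%:R.

(* The Laplace-Beltrami operator of that metric. *)
Definition laplacian (R : realType) (n : nat) (f : 'rV[R]_n -> R) (u : 'rV[R]_n) : R :=
  (metric_coef R n)^-1 * \sum_(i < n) partial i (partial i f) u.

(* Sign convention: eigenvalues are those of minus the Laplacian. *)
Definition laplace_eigenspace (R : realType) (n : nat) (L : set 'rV[R]_n)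
    (lambda : R) : set ('rV[R]_n -> R) :=
  [set f | [/\ smooth f, periodic L f &
               forall u, - laplacian f u = lambda * f u]].

Definition has_dimension (R : realType) (T : Type) (E : set (T -> R)) (d : nat) : Prop :=
  exists e : 'I_d -> T -> R,
    (forall k, E (e k)) /\
    forall f, E f ->
      exists! c : 'rV[R]_d, forall u, f u = \sum_(k < d) c 0 k * e k u.

Definition isometric (R : realType) (n k : nat) (x : 'rV[R]_n -> 'rV[R]_k) : Prop :=
  forall u (i j : 'I_n),
    dot (partial i x u) (partial j x u) = metric_coef R n *+ (i == j).

(* For x isometric with values in the sphere, x u and the partial derivatives
   of x at u are pairwise orthogonal, with squared lengths 1 and
   [metric_coef R n]; so this is the orthogonal projection of w onto the normal
   space, inside the tangent space of the sphere, of the immersion at u. *)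
Definition normal_part (R : realType) (n k : nat) (x : 'rV[R]_n -> 'rV[R]_k)
    (u : 'rV[R]_n) (w : 'rV[R]_k) : 'rV[R]_k :=
  w - dot w (x u) *: x u
    - (metric_coef R n)^-1 *: \sum_(j < n) dot w (partial j x u) *: partial j x u.

(* The value of the second fundamental form in the sphere on the coordinate
   fields i and j. *)
Definition second_fundamental_form (R : realType) (n k : nat)
    (x : 'rV[R]_n -> 'rV[R]_k) (u : 'rV[R]_n) (i j : 'I_n) : 'rV[R]_k :=
  normal_part x u (partial i (partial j x) u).

Definition mean_curvature (R : realType) (n k : nat) (x : 'rV[R]_n -> 'rV[R]_k)
    (u : 'rV[R]_n) : 'rV[R]_k :=
  n%:R^-1 *: \sum_(i < n) (metric_coef R n)^-1 *: second_fundamental_form x u i i.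

(* Minimal isometric immersions of R^n/L into the unit sphere of R^k; the
   differential is injective because [isometric x] makes the partial
   derivatives orthogonal and nonzero. *)
Definition minimal_isometric_immersion (R : realType) (n k : nat)
    (L : set 'rV[R]_n) (x : 'rV[R]_n -> 'rV[R]_k) : Prop :=
  [/\ smooth x,
      periodic L x,
      forall u, sphere (x u),
      isometric x &
      forall u, mean_curvature x u = 0].

(* Subgroups of O(k), the isometry group of the sphere. *)
Definition isometry_group (R : realType) (k : nat) (G : set 'M[R]_k) : Prop :=
  [/\ forall Q, G Q -> Q *m Q^T = 1%:M,
      G 1%:M,
      forall P Q, G P -> G Q -> G (P *m Q) &
      forall Q, G Q -> G (invmx Q)].

(* The image is an orbit of a group of isometries of the sphere.  When the image
   is compact, as for a torus, G may be replaced by its closure without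
   changing the orbit. *)
Definition homogeneous (R : realType) (n k : nat) (x : 'rV[R]_n -> 'rV[R]_k) : Prop :=
  exists (G : set 'M[R]_k) (y : 'rV[R]_k),
    isometry_group G /\ range x = [set y *m Q | Q in G].

(* H t, for t in [0, 1], is a homotopy from x to y through minimal isometric
   immersions.  R^n -> R^n/L being open, joint continuity on [0, 1] x R^n is
   joint continuity on [0, 1] x R^n/L. *)
Definition minimal_isometric_homotopy (R : realType) (n k : nat)
    (L : set 'rV[R]_n) (H : R -> 'rV[R]_n -> 'rV[R]_k)
    (x y : 'rV[R]_n -> 'rV[R]_k) : Prop :=
  [/\ {within [set tu : R * 'rV[R]_n | 0 <= tu.1 <= 1],
         continuous (fun tu : R * 'rV[R]_n => H tu.1 tu.2)},
      forall t : R, 0 <= t <= 1 -> minimal_isometric_immersion L (H t),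
      H 0 = x &
      H 1 = y].

(* Main.v *)
(* Write x = e A with e : R^n -> R^d a row of functions forming a basis of the
   eigenspace (Takahashi).  Being a minimal isometric immersion is an affine
   condition on the positive semidefinite Gram matrix A A^T.  The eigenspace is
   finite-dimensional and stable under the commuting operators partial i, and
   lattice periodicity makes these semisimple with imaginary eigenvalues; so,
   over C, the eigenspace is spanned by waves exp(i <eta_k, u>) with distinct
   eta_k, without any appeal to Fourier series.  The constant term of
   <partial_i x, partial_j x> then gives weights a_k >= 0 with
   sum_k a_k eta_k eta_k^T proportional to the identity, and Caratheodory's
   theorem in the space of symmetric matrices leaves at most n(n+1)/2 nonzero
   weights b_k.  The waves sqrt(b_k) exp(i <eta_k, u>) have a
   translation-invariant Gram matrix B B^T.  Diagonalizing A A^T and B B^T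
   simultaneously, the segment between them lifts to a path of d x d factors
   starting at A; here it matters that the target dimension d equals the
   dimension of the eigenspace. *)
Require Import Defs.
From mathcomp Require Import all_boot all_order all_algebra.
From mathcomp Require Import all_classical all_reals all_analysis.
From mathcomp Require Import ring lra complex.
Set Implicit Arguments.
Unset Strict Implicit.
Unset Printing Implicit Defensive.
Import Order.TTheory GRing.Theory Num.Theory.
Import numFieldNormedType.Exports.
Local Open Scope classical_set_scope.
Local Open Scope ring_scope.

(** * Gram matrices over a real field *)

Definition sqnorm (F : realFieldType) (d : nat) (v : 'rV[F]_d) : F :=
  (v *m v^T) 0 0.

Lemma sqnormE (F : realFieldType) (d : nat) (v : 'rV[F]_d) :
  sqnorm v = \sum_(i < d) v 0 i ^+ 2.
Proof. by rewrite /sqnorm mxE; apply: eq_bigr => i _; rewrite mxE expr2. Qed.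

Lemma sqnorm_ge0 (F : realFieldType) (d : nat) (v : 'rV[F]_d) : 0 <= sqnorm v.
Proof. by rewrite sqnormE sumr_ge0 // => i _; rewrite sqr_ge0. Qed.

Lemma sqnorm_eq0 (F : realFieldType) (d : nat) (v : 'rV[F]_d) :
  (sqnorm v == 0) = (v == 0).
Proof.
apply/idP/eqP => [|->]; last by rewrite /sqnorm mul0mx mxE.
rewrite sqnormE psumr_eq0 => [/allP v0|i _]; last exact: sqr_ge0.
apply/rowP => i; rewrite mxE; apply/eqP.
by have := v0 i (mem_index_enum _); rewrite sqrf_eq0.
Qed.

Lemma gram_entry (F : comPzRingType) (m p d : nat) (A : 'M[F]_(m, d))
    (B : 'M[F]_(p, d)) i j : (A *m B^T) i j = (row i A *m (row j B)^T) 0 0.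
Proof. by rewrite !mxE; apply: eq_bigr => k _; rewrite !mxE. Qed.

Lemma rV_mulC (F : comPzRingType) (d : nat) (v w : 'rV[F]_d) :
  v *m w^T = w *m v^T.
Proof.
by rewrite -[LHS]trmxK trmx_mul trmxK [w *m _]mx11_scalar tr_scalar_mx
  -mx11_scalar.
Qed.

(** Householder reflection in the hyperplane orthogonal to [a - b]. The last clause says that it
    fixes this hyperplane, so that rows already matched stay in place when reflections are
    composed. *)
Lemma reflection (F : realFieldType) (d : nat) (a b : 'rV[F]_d) :
  sqnorm a = sqnorm b ->
  exists H : 'M[F]_d,
    [/\ H *m H^T = 1%:M, a *m H = b &
        forall r : 'rV[F]_d, r *m a^T = r *m b^T -> r *m H = r].
Proof.
move=> ab; pose w := a - b; have [w0|w0] := eqVneq w 0.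
  exists 1%:M; split=> [||r _]; rewrite ?trmx1 mulmx1 //.
  exact: subr0_eq.
have nw : sqnorm w != 0 by rewrite sqnorm_eq0.
pose c := 2 / sqnorm w; pose H := 1%:M - c *: (w^T *m w).
have HT : H^T = H by rewrite /H linearB linearZ /= trmx1 trmx_mul trmxK.
have act (r : 'rV_d) : r *m H = r - (c * (r *m w^T) 0 0) *: w.
  rewrite mulmxBr mulmx1 -scalemxAr mulmxA -scalerA -[_ 0 0 *: w]mul_scalar_mx.
  by rewrite -mx11_scalar.
exists H; split.
- rewrite HT; apply/row_matrixP => i; rewrite rowE [RHS]rowE mulmx1 mulmxA.
  set r := delta_mx 0 i; rewrite act act mulmxBl -scalemxAl -addrA -opprD.
  rewrite -scalerDl [X in X *: w](_ : _ = 0) ?scale0r ?subr0 //.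
  have -> (M N : 'M[F]_1) t : (M - t *: N) 0 0 = M 0 0 - t * N 0 0 by rewrite !mxE.
  by rewrite -/(sqnorm w) /c; field.
- rewrite act (_ : c * _ = 1) ?scale1r ?subKr //.
  (* This is where the equality of the norms of [a] and [b] enters. *)
  have -> : (a *m w^T) 0 0 = sqnorm w / 2.
    have mB (M N : 'M[F]_1) : (M - N) 0 0 = M 0 0 - N 0 0 by rewrite !mxE.
    rewrite /sqnorm /w linearB /= !mulmxBr !mulmxBl !mB [b *m a^T]rV_mulC.
    by rewrite -/(sqnorm a) -/(sqnorm b) ab; field.
  by rewrite /c; field.
- move=> r rab; rewrite act (_ : r *m w^T = 0) ?mxE ?mulr0 ?scale0r ?subr0 //.
  by rewrite linearB /= mulmxBr rab subrr.
Qed.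

(** Rows are matched one at a time. The reflection carrying the current image of row [k] of [A] to
    row [k] of [B] fixes the earlier rows, because equal Gram matrices give them the same inner
    product with both vectors. *)
Lemma orthogonal_extension (F : realFieldType) (m d : nat) (A B : 'M[F]_(m, d)) :
  A *m A^T = B *m B^T -> exists Q : 'M[F]_d, Q *m Q^T = 1%:M /\ A *m Q = B.
Proof.
move=> AB.
have ABij i j : row i A *m (row j A)^T = row i B *m (row j B)^T.
  by rewrite [LHS]mx11_scalar [RHS]mx11_scalar -!gram_entry AB.
suff /(_ m (leqnn m)) [Q [QQ HQ]] : forall k, (k <= m)%N -> exists Q : 'M[F]_d,
    Q *m Q^T = 1%:M /\ forall i : 'I_m, (i < k)%N -> row i A *m Q = row i B.
  by exists Q; split => //; apply/row_matrixP => i; rewrite row_mul HQ.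
elim=> [|k IHk] km; first by exists 1%:M; rewrite trmx1 mulmx1.
have [Q [QQ HQ]] := IHk (ltnW km); pose i0 := Ordinal km.
have [|H [HH Ha Hr]] := @reflection F d (row i0 A *m Q) (row i0 B).
  rewrite /sqnorm trmx_mul mulmxA -[_ *m Q *m _]mulmxA QQ mulmx1.
  by rewrite ABij.
exists (Q *m H); split.
  by rewrite trmx_mul mulmxA -[Q *m H *m _]mulmxA HH mulmx1.
move=> i; rewrite ltnS leq_eqVlt mulmxA => /orP[/eqP ik|ik].
  by rewrite (_ : i = i0) //; apply: val_inj.
rewrite HQ // Hr // -HQ // trmx_mul mulmxA -[_ *m Q *m _]mulmxA QQ mulmx1.
by rewrite ABij HQ.
Qed.

(** A complex eigenvector [x + i y] exists by algebraic closedness. Symmetry of [A] equates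
    [x A y^T] with [y A x^T], which forces the imaginary part of the eigenvalue to vanish; then
    whichever of [x], [y] is nonzero is a real eigenvector. *)
Lemma symmetric_eigenvector (R : rcfType) (n : nat) (A : 'M[R]_n.+1) :
  A^T = A -> exists (a : R) (v : 'rV[R]_n.+1), v != 0 /\ v *m A = a *: v.
Proof.
move=> AT; pose toC := real_complex R.
have [a /eigenvalueP[z zA z0]] :=
  @eigenvalue_closed (complex R) n.+1 (map_mx toC A) isT.
pose x := map_mx (@complex.Re R) z; pose y := map_mx (@complex.Im R) z.
have xA : x *m A = complex.Re a *: x - complex.Im a *: y.
  apply/rowP => j; move/rowP/(_ j)/(congr1 (@complex.Re R)): zA.
  rewrite !mxE raddf_sum /= => E.
  transitivity (complex.Re (a * z 0 j)); last by case: (a) (z 0 j) => ? ? [].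
  rewrite -E; apply: eq_bigr => k _; rewrite !mxE.
  by case: (z 0 k) => ? ? /=; rewrite mulr0 subr0.
have yA : y *m A = complex.Im a *: x + complex.Re a *: y.
  apply/rowP => j; move/rowP/(_ j)/(congr1 (@complex.Im R)): zA.
  rewrite !mxE raddf_sum /= => E.
  transitivity (complex.Im (a * z 0 j)).
    rewrite -E; apply: eq_bigr => k _; rewrite !mxE.
    by case: (z 0 k) => ? ? /=; rewrite mulr0 add0r.
  by case: (a) (z 0 j) => ? ? [] ? ? /=; rewrite addrC.
have sym : (x *m A *m y^T) = (y *m A *m x^T).
  by rewrite rV_mulC trmx_mul AT mulmxA.
have nz : sqnorm x + sqnorm y != 0.
  rewrite paddr_eq0 ?sqnorm_ge0 // !sqnorm_eq0; apply: contra z0.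
  case/andP => /eqP x0 /eqP y0; apply/eqP/rowP => j.
  move/rowP/(_ j): x0; move/rowP/(_ j): y0; rewrite !mxE.
  by case: (z 0 j) => ? ? /= -> ->.
have a0 : complex.Im a = 0.
  apply/(mulIf nz); rewrite mul0r.
  move: sym; rewrite xA yA mulmxBl mulmxDl -!scalemxAl [y *m x^T]rV_mulC.
  move/matrixP/(_ 0 0); rewrite !mxE => E; rewrite /sqnorm !mxE; lra.
have [x0|x0] := eqVneq x 0.
  exists (complex.Re a), y; rewrite yA a0 scale0r add0r; split=> //.
  apply: contra nz => /eqP y0; rewrite x0 y0.
  by rewrite (eqP (_ : sqnorm 0 == 0)) ?sqnorm_eq0 // addr0.
by exists (complex.Re a), x; rewrite xA a0 scale0r subr0.
Qed.

(** Deflation: an orthogonal [Q] whose first row is a unit eigenvector conjugates [A] to a block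
    diagonal matrix, and the induction hypothesis treats the lower block. *)
Lemma symmetric_spectral (R : rcfType) (n : nat) (A : 'M[R]_n) :
  A^T = A ->
  exists (U : 'M[R]_n) (a : 'rV[R]_n),
    U *m U^T = 1%:M /\ A = U^T *m diag_mx a *m U.
Proof.
elim: n A => [|n IHn] A AT.
  by exists 1%:M, 0; split; rewrite ?trmx1 ?mulmx1 //; apply/matrixP => -[].
have [a [v [v0 vA]]] := symmetric_eigenvector AT.
pose u := (Num.sqrt (sqnorm v))^-1 *: v.
have sv : 0 < sqnorm v by rewrite lt_def sqnorm_eq0 v0 sqnorm_ge0.
have u1 : sqnorm u = 1.
  rewrite /u /sqnorm linearZ /= -scalemxAl -scalemxAr scalerA mxE.
  rewrite -/(sqnorm v) -invfM -expr2 sqr_sqrtr ?mulVf ?gt_eqF //; exact: ltW.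
have uA : u *m A = a *: u by rewrite -scalemxAl vA !scalerA mulrC.
have [|Q [QQ Qu]] := @orthogonal_extension R 1 n.+1 (delta_mx 0 0) u.
  rewrite trmx_delta mul_delta_mx; apply/matrixP => i j.
  by rewrite !ord1 -/(sqnorm u) u1 mxE.
have QQ' : Q^T *m Q = 1%:M by apply: mulmx1C.
pose S := Q *m A *m Q^T.
have ST : S^T = S by rewrite /S !trmx_mul trmxK AT mulmxA.
have S0 : (delta_mx 0 0 : 'rV_n.+1) *m S = a *: delta_mx 0 0.
  by rewrite /S !mulmxA Qu uA -scalemxAl -Qu -mulmxA QQ mulmx1.
(* [S1] is [S] with its size read as [1 + n], the form required by block operations. *)
have [S1 S1E] : exists S1 : 'M[R]_(1 + n), S1 = S by exists S.
have Sb : S1 = block_mx a%:M 0 0 (drsubmx S1).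
  have row0 j : S1 0 j = a * (j == 0)%:R.
    rewrite S1E; move/matrixP/(_ 0 j): S0; rewrite -rowE mxE => ->.
    by rewrite !mxE eqxx.
  have col0 j : S1 j 0 = a * (j == 0)%:R.
    by rewrite -row0 S1E -{1}ST mxE.
  have l0 : lshift n (0 : 'I_1) = (0 : 'I_n.+1) by apply: val_inj.
  rewrite -[LHS]submxK; congr block_mx; apply/matrixP => i j.
  - by rewrite !ord1 !mxE l0 row0 mulr1.
  - by rewrite ord1 !mxE l0 row0 mulr0.
  - by rewrite [j]ord1 !mxE l0 col0 mulr0.
have [|U [b [UU Ub]]] := IHn (drsubmx S1).
  by rewrite trmx_drsub S1E ST.
pose W : 'M[R]_(1 + n) := block_mx 1%:M 0 0 U.
pose Q1 : 'M[R]_(1 + n) := Q.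
have WT : W^T = block_mx 1%:M 0 0 U^T by rewrite tr_block_mx trmx1 !trmx0.
have WW : W *m W^T = 1%:M.
  rewrite WT /W mulmx_block !mul0mx !mulmx0 !addr0 !add0r UU mulmx1.
  by rewrite -scalar_mx_block.
have WS : W^T *m diag_mx (row_mx a%:M b) *m W = S1.
  rewrite Sb diag_mx_row WT /W !mulmx_block !mul0mx !mulmx0 !addr0 !add0r.
  rewrite !mul1mx !mulmx1 -Ub; congr block_mx.
    by apply/matrixP => i j; rewrite !ord1 !mxE eqxx.
  by rewrite mul0mx.
exists (W *m Q1), (row_mx a%:M b); split.
  by rewrite trmx_mul mulmxA -[W *m Q1 *m _]mulmxA QQ mulmx1 WW.
have -> : A = Q1^T *m S1 *m Q1.
  by rewrite S1E /S /Q1 !mulmxA QQ' mul1mx -mulmxA QQ' mulmx1.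
by rewrite -WS trmx_mul !mulmxA.
Qed.

Lemma mulmx_tr_diag (R : comPzRingType) (m d : nat) (A : 'M[R]_(m, d)) (a : 'rV[R]_d) :
  A *m diag_mx a *m A^T = \matrix_(i, j) \sum_k a 0 k * (A i k * A j k).
Proof.
apply/matrixP => i j; rewrite !mxE; apply: eq_bigr => k _.
by rewrite mul_mx_diag !mxE mulrAC mulrC.
Qed.

Lemma row_diag_mul (R : pzRingType) (m d : nat) (a : 'rV[R]_m) (A : 'M[R]_(m, d)) k :
  row k (diag_mx a *m A) = a 0 k *: row k A.
Proof. by rewrite row_mul row_diag_mx -scalemxAl -rowE. Qed.

(** Simultaneous diagonalization by congruence of two positive semidefinite matrices whose sum may
    be singular. The sum is written [L L^T], and [A = L Y], [B = L Z] with [Y Y^T + Z Z^T] equal to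
    a projection [J] that [L] absorbs. Diagonalizing [Y Y^T] alone then diagonalizes both, with
    complementary weights [a] and [1 - a]. The factor [Q] recovers [A] itself and not only its Gram
    matrix. *)
Lemma gram_path (R : rcfType) (d q : nat) (A : 'M[R]_d) (B : 'M[R]_(d, q)) :
  exists (K Q : 'M[R]_d) (a b : 'rV[R]_d),
    [/\ forall k, 0 <= a 0 k /\ 0 <= b 0 k, Q *m Q^T = 1%:M,
        A = K *m diag_mx (map_mx Num.sqrt a) *m Q,
        A *m A^T = K *m diag_mx a *m K^T & B *m B^T = K *m diag_mx b *m K^T].
Proof.
pose G := row_mx A B.
have [|U [s [UU GG]]] := @symmetric_spectral R d (G *m G^T).
  by rewrite trmx_mul trmxK.
have U'U : U^T *m U = 1%:M by apply: mulmx1C.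
have [H HE] : exists H, H = U *m G by exists (U *m G).
have HH : H *m H^T = diag_mx s.
  rewrite HE trmx_mul mulmxA -[U *m G *m _]mulmxA GG -!mulmxA UU mulmx1.
  by rewrite mulmxA UU mul1mx.
have sE k : s 0 k = sqnorm (row k H).
  by rewrite /sqnorm -gram_entry HH !mxE eqxx.
have s0 k : 0 <= s 0 k by rewrite sE sqnorm_ge0.
(* Where [s] vanishes, [r'] takes the default value [0]; this is harmless because the corresponding
   row of [H] is zero. *)
pose r := map_mx Num.sqrt s; pose r' := map_mx GRing.inv r.
have rr' : diag_mx r *m diag_mx r' *m H = H.
  apply/row_matrixP => k; rewrite -mulmxA !row_diag_mul scalerA !mxE.
  have [sk|sk] := eqVneq (s 0 k) 0.
    move/eqP: sk; rewrite sE sqnorm_eq0 => /eqP ->; by rewrite scaler0.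
  by rewrite mulfV ?scale1r // sqrtr_eq0 -ltNge lt_def sk s0.
have [L LE] : exists L, L = U^T *m diag_mx r by exists (U^T *m diag_mx r).
have [W WE] : exists W, W = diag_mx r' *m H by exists (diag_mx r' *m H).
have LW : L *m W = G 
  by rewrite LE WE -mulmxA [diag_mx r *m _]mulmxA rr' HE mulmxA U'U mul1mx.
have [J JE] : exists J, J = W *m W^T by exists (W *m W^T).
have sqrt_s k : s 0 k != 0 ->
    (Num.sqrt (s 0 k))^-1 * (s 0 k * (Num.sqrt (s 0 k))^-1) = 1.
  move=> sk; have : Num.sqrt (s 0 k) != 0 by rewrite sqrtr_eq0 -ltNge lt_def sk s0.
  have : s 0 k = Num.sqrt (s 0 k) ^+ 2 by rewrite sqr_sqrtr.
  by move: (Num.sqrt (s 0 k)) => t -> t0; field.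
(* These diagonal entries are 1 where [s] is nonzero and 0 elsewhere. *)
have Jdiag : J = diag_mx (\row_k (r' 0 k * (s 0 k * r' 0 k))).
  rewrite JE WE trmx_mul tr_diag_mx -!mulmxA [H *m _]mulmxA HH !mulmx_diag.
  by congr diag_mx; apply/rowP => k; rewrite !mxE.
have LJ : L *m J = L.
  rewrite Jdiag LE -mulmxA mulmx_diag; congr (_ *m diag_mx _).
  apply/rowP => k; rewrite !mxE.
  have [->|sk] := eqVneq (s 0 k) 0; first by rewrite sqrtr0 !mul0r.
  by rewrite sqrt_s ?mulr1.
have J_le (v : 'rV[R]_d) : (v *m J *m v^T) 0 0 <= sqnorm v.
  rewrite Jdiag mulmx_tr_diag sqnormE mxE ler_sum // => k _.
  rewrite -expr2 -{2}[v 0 k ^+ 2]mul1r ler_wpM2r ?sqr_ge0 // !mxE.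
  have [->|sk] := eqVneq (s 0 k) 0; first by rewrite mul0r mulr0.
  by rewrite sqrt_s.
pose Y := lsubmx W; pose Z := rsubmx W.
have WYZ : W = row_mx Y Z by rewrite hsubmxK.
have JYZ : J = Y *m Y^T + Z *m Z^T.
  by rewrite JE WYZ tr_row_mx mul_row_col.
have [AY BZ] : L *m Y = A /\ L *m Z = B.
  by apply: eq_row_mx; rewrite -mul_mx_row -WYZ LW.
have [|V [a [VV YY]]] := @symmetric_spectral R d (Y *m Y^T).
  by rewrite trmx_mul trmxK.
have V'V : V^T *m V = 1%:M by apply: mulmx1C.
have VY : V *m Y *m (V *m Y)^T = diag_mx a.
  rewrite trmx_mul mulmxA -[V *m Y *m _]mulmxA YY -!mulmxA VV mulmx1.
  by rewrite mulmxA VV mul1mx.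
have aE k : a 0 k = sqnorm (row k (V *m Y)).
  by rewrite /sqnorm -gram_entry VY !mxE eqxx.
have a0 k : 0 <= a 0 k by rewrite aE sqnorm_ge0.
(* [a 0 k] and the squared norm of row [k] of [V *m Z] add up to the value of [J] on a unit vector,
   which is at most 1. *)
have a1 k : a 0 k <= 1.
  have := J_le (row k V).
  rewrite JYZ mulmxDr mulmxDl mxE.
  have -> : (row k V *m (Y *m Y^T) *m (row k V)^T) 0 0 = a 0 k.
    by rewrite aE row_mul /sqnorm trmx_mul !mulmxA.
  have -> : (row k V *m (Z *m Z^T) *m (row k V)^T) 0 0 = sqnorm (row k (V *m Z)).
    by rewrite row_mul /sqnorm trmx_mul !mulmxA.
  rewrite {2}/sqnorm -gram_entry VV !mxE eqxx; apply: le_trans.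
  by rewrite lerDl sqnorm_ge0.
(* Both matrices have Gram matrix [diag_mx a], so an orthogonal [Q] relates them even when some
   weights vanish. *)
have [|Q [QQ QE]] := @orthogonal_extension R d d (diag_mx (map_mx Num.sqrt a)) (V *m Y).
  rewrite VY tr_diag_mx mulmx_diag; congr diag_mx.
  by apply/rowP => k; rewrite !mxE -expr2 sqr_sqrtr.
have AA : A *m A^T = L *m V^T *m diag_mx a *m (L *m V^T)^T.
  rewrite -VY -AY !trmx_mul !trmxK !mulmxA -[L *m V^T *m V]mulmxA V'V mulmx1.
  by rewrite -[_ *m V^T *m V]mulmxA V'V mulmx1.
exists (L *m V^T), Q, a, (\row_k (1 - a 0 k)); split=> //.
- by move=> k; rewrite mxE subr_ge0.
- by rewrite -mulmxA QE mulmxA -[L *m V^T *m V]mulmxA V'V mulmx1.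
have -> : diag_mx (\row_k (1 - a 0 k)) = 1%:M - diag_mx a.
  by apply/matrixP => i j; rewrite !mxE mulrnBl.
rewrite mulmxBr mulmxBl -AA mulmx1 trmx_mul trmxK mulmxA.
rewrite -[L *m V^T *m V]mulmxA V'V mulmx1 -{1}LJ JYZ mulmxDr mulmxDl.
rewrite -AY -BZ !trmx_mul !mulmxA.
by rewrite addrAC subrr add0r.
Qed.

(** * Iterated partial derivatives *)

Lemma is_derive_line (R : realType) (U V : normedModType R) (f : U -> V)
    (u v : U) (t : R) :
  differentiable f (u + t *: v) ->
  is_derive t 1 (fun s => f (u + s *: v)) ('D_v f (u + t *: v)).
Proof.
move=> df; have dv : derivable f (u + t *: v) v by exact: diff_derivable.
have E : (fun h : R => h^-1 *: (((fun s => f (u + s *: v)) \o shift t) (h *: 1)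
      - f (u + t *: v))) =
    (fun h : R => h^-1 *: ((f \o shift (u + t *: v)) (h *: v) - f (u + t *: v))).
  apply/funext => h /=; congr (_ *: (f _ - _)).
  by rewrite scalerDl addrCA /GRing.scale /= mulr1.
by apply: DeriveDef; rewrite /derivable /derive E.
Qed.

Lemma derive_sum_partial (R : realType) (n : nat) (V : normedModType R)
    (f : 'rV[R]_n -> V) (u v : 'rV[R]_n) :
  differentiable f u -> 'D_v f u = \sum_(i < n) v 0 i *: partial i f u.
Proof.
move=> df; rewrite deriveE // {1}[v]row_sum_delta linear_sum.
by apply: eq_bigr => i _; rewrite linearZ /partial deriveE.
Qed.

(** * Symmetry of mixed derivatives *)

Lemma derivative_mean_value (R : realType) (f df : R -> R) (a b : R) :
  a < b -> (forall x : R, is_derive x 1 f (df x)) ->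
  exists2 c, a < c < b & f b - f a = df c * (b - a).
Proof.
move=> ab fdf; have [|c] := @MVT R f df a b ab (fun x _ => fdf x).
  apply: continuous_subspaceT => x; apply: differentiable_continuous.
  by apply/derivable1_diffP; case: (fdf x).
by rewrite in_itv /=; exists c.
Qed.

(** The mean value theorem is used twice: on [phi] in the direction [a], then on the derivative
    along [a] in the direction [b]. *)
Lemma second_difference (R : realType) (U : normedModType R) (f : U -> R)
    (u a b : U) (h : R) :
  0 < h -> (forall w, differentiable f w) ->
  (forall w, differentiable (fun w => 'D_a f w) w) ->
  exists c r, [/\ 0 < c < h, 0 < r < h &
    f (u + h *: a + h *: b) - f (u + h *: a) - f (u + h *: b) + f u =
    h ^+ 2 * 'D_b (fun w => 'D_a f w) (u + c *: a + r *: b)].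
Proof.
move=> h0 df daf.
pose phi (s : R) := f (u + h *: b + s *: a) - f (u + s *: a).
have [s|c ch] := @derivative_mean_value R phi
    (fun s => 'D_a f (u + h *: b + s *: a) - 'D_a f (u + s *: a)) 0 h h0.
  by apply: is_deriveB; apply: is_derive_line.
rewrite subr0 => E1.
have [s|r rh] := @derivative_mean_value R (fun s => 'D_a f (u + c *: a + s *: b))
    (fun s => 'D_b (fun w => 'D_a f w) (u + c *: a + s *: b)) 0 h h0.
  exact: is_derive_line.
rewrite subr0 scale0r addr0 => E2.
exists c, r; split=> //.
move: E1; rewrite [u + h *: b + c *: a]addrAC E2 /phi scale0r !addr0.
rewrite [u + h *: b + h *: a]addrAC => E1.
by rewrite -[RHS]mulrC expr2 mulrA -E1; ring.
Qed.

Lemma eq_of_continuous (R : realType) (U : normedModType R) (F G : U -> R) (u : U) :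
  {for u, continuous F} -> {for u, continuous G} ->
  (forall d, 0 < d -> exists v w, [/\ `|v| < d, `|w| < d & F (u + v) = G (u + w)]) ->
  F u = G u.
Proof.
move=> cF cG FG; apply/eqP; rewrite -subr_eq0 -normr_le0.
apply/ler_addgt0Pl => e e0; rewrite addr0.
have e2 : 0 < e / 2 by rewrite divr_gt0.
move/cvgrPdist_le: cF => /(_ _ e2)/nbhs_ballP[d1 /= d10 H1].
move/cvgrPdist_le: cG => /(_ _ e2)/nbhs_ballP[d2 /= d20 H2].
have d0 : 0 < Num.min d1 d2 by rewrite lt_min d10.
have [v [w [vd wd E]]] := FG _ d0.
have B1 : ball u d1 (u + v).
  by rewrite -ball_normE /= opprD addNKr normrN (lt_le_trans vd) // ge_min lexx.
have B2 : ball u d2 (u + w).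
  by rewrite -ball_normE /= opprD addNKr normrN (lt_le_trans wd) // ge_min lexx orbT.
have := lerD (H1 _ B1) (H2 _ B2); rewrite /= E -splitr; apply: le_trans.
by rewrite [`|G u - _|]distrC ler_distD.
Qed.

(** The second difference is symmetric in [a] and [b], and divided by [h ^+ 2] it is a value of
    either mixed derivative near [u]; continuity concludes as [h] shrinks. *)
Lemma derive_commute (R : realType) (U : normedModType R) (f : U -> R)
    (u a b : U) :
  (forall w, differentiable f w) ->
  (forall w, differentiable (fun w => 'D_a f w) w) ->
  (forall w, differentiable (fun w => 'D_b f w) w) ->
  {for u, continuous (fun w => 'D_b (fun w => 'D_a f w) w)} ->
  {for u, continuous (fun w => 'D_a (fun w => 'D_b f w) w)} ->
  'D_a (fun w => 'D_b f w) u = 'D_b (fun w => 'D_a f w) u.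
Proof.
move=> df daf dbf cba cab; apply: (eq_of_continuous cab cba) => d d0.
(* The summand 1 keeps [m] positive when [a] and [b] vanish; with step [d / m] all intermediate
   points lie within [d] of [u]. *)
pose m := 1 + `|a| + `|b|.
have m0 : 0 < m by rewrite /m -addrA ltr_pwDl // addr_ge0.
pose h := d / m.
have h0 : 0 < h by rewrite divr_gt0.
have close (c r : R) (v w : U) : 0 < c < h -> 0 < r < h -> `|v| + `|w| < m ->
    `|c *: v + r *: w| < d.
  move=> /andP[c0 ch] /andP[r0 rh] vw.
  rewrite (le_lt_trans (ler_normD _ _)) // !normrZ (gtr0_norm c0) (gtr0_norm r0).
  rewrite (@le_lt_trans _ _ (h * (`|v| + `|w|))) //.
    by rewrite mulrDr lerD // ler_wpM2r // ltW.
  by rewrite -[ltRHS](divfK (lt0r_neq0 m0)) -/h ltr_pM2l.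
have ab_m : `|a| + `|b| < m by rewrite /m -addrA ltrDr.
have ba_m : `|b| + `|a| < m by rewrite addrC.
have [c [r [ch rh E1]]] := second_difference u b h0 df daf.
have [c' [r' [ch' rh' E2]]] := second_difference u a h0 df dbf.
exists (c' *: b + r' *: a), (c *: a + r *: b); split; [exact: close|exact: close|].
rewrite !addrA; apply: (mulfI (expf_neq0 2 (lt0r_neq0 h0))); apply: etrans (esym E2) _.
by apply: etrans E1; rewrite [u + h *: b + _]addrAC; ring.
Qed.

(** * Calculus of smooth maps *)

Lemma smooth_partial (R : realType) (n : nat) (V : normedModType R)
    (f : 'rV[R]_n -> V) (i : 'I_n) : smooth f -> smooth (partial i f).
Proof.
move=> sf s u.
by have := sf (rcons s i) u; rewrite foldr_rcons.
Qed.

Lemma smooth_differentiable (R : realType) (n : nat) (V : normedModType R)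
    (f : 'rV[R]_n -> V) (u : 'rV[R]_n) : smooth f -> differentiable f u.
Proof. by move=> /(_ [::] u). Qed.

Lemma partial_commute (R : realType) (n : nat) (f : 'rV[R]_n -> R) (i j : 'I_n) :
  smooth f -> partial i (partial j f) = partial j (partial i f).
Proof.
move=> sf; apply/funext => u; apply: derive_commute => [w|w|w||].
- exact: smooth_differentiable.
- by apply: smooth_differentiable; apply: (smooth_partial i).
- by apply: smooth_differentiable; apply: (smooth_partial j).
- apply: differentiable_continuous; apply: smooth_differentiable.
  by apply: (smooth_partial j); apply: smooth_partial.
- apply: differentiable_continuous; apply: smooth_differentiable.
  by apply: (smooth_partial i); apply: smooth_partial.
Qed.

Lemma periodic_partial (R : realType) (n : nat) (V : normedModType R)
    (L : set 'rV[R]_n) (f : 'rV[R]_n -> V) (i : 'I_n) :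
  Defs.periodic L f -> Defs.periodic L (partial i f).
Proof.
move=> pf u v Lv; rewrite /partial /derive.
suff -> : (fun h : R => h^-1 *: ((f \o shift (u + v)) (h *: delta_mx 0 i) - f (u + v))) =
  (fun h : R => h^-1 *: ((f \o shift u) (h *: delta_mx 0 i) - f u)) by [].
by apply/funext => h /=; rewrite addrA !(pf _ _ Lv).
Qed.

Lemma is_derive_comb (R : realType) (U V : normedModType R) (d : nat)
    (e : 'I_d -> U -> R) (w : 'I_d -> V) (u v : U) :
  (forall k, differentiable (e k) u) ->
  differentiable (fun u => \sum_(k < d) e k u *: w k) u /\
  'D_v (fun u => \sum_(k < d) e k u *: w k) u = \sum_(k < d) 'D_v (e k) u *: w k.
Proof.
move=> de.
have -> : (fun u => \sum_(k < d) e k u *: w k) =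
          \sum_(k < d) (fun u => e k u *: w k).
  by apply/funext => t; rewrite fct_sumE.
have dk k : differentiable (fun u => e k u *: w k) u by apply: differentiableZl.
split; first exact: differentiable_sum.
rewrite derive_sum => [|k]; last exact: diff_derivable.
by apply: eq_bigr => k _; rewrite deriveE // diffZl // deriveE.
Qed.

(** The iterated form yields both the smoothness of a combination, which concerns all sequences of
    indices, and its first derivatives. *)
Lemma iter_partial_comb (R : realType) (n : nat) (V : normedModType R) (d : nat)
    (e : 'I_d -> 'rV[R]_n -> R) (w : 'I_d -> V) (s : seq 'I_n) :
  (forall k, smooth (e k)) ->
  foldr (fun i g => partial i g) (fun u => \sum_(k < d) e k u *: w k) s =
  (fun u => \sum_(k < d) foldr (fun i g => partial i g) (e k) s u *: w k).
Proof.
move=> se; elim: s => //= i s ->; apply/funext => u.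
exact: (is_derive_comb _ _ (fun k => se k s u)).2.
Qed.

Lemma smooth_comb (R : realType) (n : nat) (V : normedModType R) (d : nat)
    (e : 'I_d -> 'rV[R]_n -> R) (w : 'I_d -> V) :
  (forall k, smooth (e k)) -> smooth (fun u => \sum_(k < d) e k u *: w k).
Proof.
move=> se s u; rewrite iter_partial_comb //.
exact: (is_derive_comb w 0 (fun k => se k s u)).1.
Qed.

Lemma partial_comb (R : realType) (n : nat) (V : normedModType R) (d : nat)
    (e : 'I_d -> 'rV[R]_n -> R) (w : 'I_d -> V) (i : 'I_n) :
  (forall k, smooth (e k)) ->
  partial i (fun u => \sum_(k < d) e k u *: w k) =
  (fun u => \sum_(k < d) partial i (e k) u *: w k).
Proof. exact: (iter_partial_comb w [:: i]). Qed.

Lemma iter_partial_coord (R : realType) (n d : nat) (x : 'rV[R]_n -> 'rV[R]_d)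
    (k : 'I_d) (s : seq 'I_n) :
  smooth x ->
  foldr (fun i g => partial i g) (fun u => x u 0 k) s =
  (fun u => foldr (fun i g => partial i g) x s u 0 k).
Proof.
move=> sx; elim: s => //= i s ->; apply/funext => u.
by rewrite [in RHS]/partial derive_mx ?mxE //; apply: diff_derivable; apply: sx.
Qed.

Lemma smooth_coord (R : realType) (n d : nat) (x : 'rV[R]_n -> 'rV[R]_d) (k : 'I_d) :
  smooth x -> smooth (fun u => x u 0 k).
Proof.
move=> sx s u; rewrite iter_partial_coord //.
exact: (@differentiable_comp _ _ _ _ _ (fun N : 'rV[R]_d => N 0 k) _ (sx s u)
  (differentiable_coord _ _ _)).
Qed.

Lemma partial_coord (R : realType) (n d : nat) (x : 'rV[R]_n -> 'rV[R]_d)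
    (k : 'I_d) (i : 'I_n) :
  smooth x -> partial i (fun u => x u 0 k) = (fun u => partial i x u 0 k).
Proof. exact: (iter_partial_coord k [:: i]). Qed.

Lemma partial_dot (R : realType) (n d : nat) (x y : 'rV[R]_n -> 'rV[R]_d)
    (i : 'I_n) (u : 'rV[R]_n) :
  smooth x -> smooth y ->
  partial i (fun u => dot (x u) (y u)) u =
  dot (partial i x u) (y u) + dot (x u) (partial i y u).
Proof.
move=> sx sy.
have dc (z : 'rV[R]_n -> 'rV[R]_d) k : smooth z ->
    derivable (fun u => z u 0 k) u (delta_mx 0 i).
  by move=> sz; apply: diff_derivable; apply: smooth_differentiable; apply: smooth_coord.
have -> : (fun u => dot (x u) (y u)) =
    \sum_(k < d) ((fun u => x u 0 k) * (fun u => y u 0 k)).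
  by apply/funext => t; rewrite fct_sumE.
rewrite /partial derive_sum => [|k]; last by apply: derivableM; apply: dc.
rewrite /dot -big_split; apply: eq_bigr => k _ /=.
rewrite deriveM; try exact: dc.
have pE (z : 'rV[R]_n -> 'rV[R]_d) : smooth z ->
    'D_(delta_mx 0 i) (fun u => z u 0 k) u = 'D_(delta_mx 0 i) z u 0 k.
  by move=> sz; rewrite -[LHS]/(partial i (fun u => z u 0 k) u) partial_coord.
by rewrite !pE // /GRing.scale /= addrC [_ * y u 0 k]mulrC.
Qed.

(** * Takahashi's theorem and frames of the eigenspace *)

Lemma dotE (R : realType) (d : nat) (v w : 'rV[R]_d) : dot v w = (v *m w^T) 0 0.
Proof. by rewrite mxE; apply: eq_bigr => k _; rewrite mxE. Qed.

Lemma dotC (R : realType) (d : nat) (v w : 'rV[R]_d) : dot v w = dot w v.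
Proof. by apply: eq_bigr => k _; rewrite mulrC. Qed.

Lemma dot_suml (R : realType) (d : nat) (I : finType) (v : I -> 'rV[R]_d) w :
  dot (\sum_i v i) w = \sum_i dot (v i) w.
Proof. by rewrite dotE mulmx_suml summxE; apply: eq_bigr => i _; rewrite dotE. Qed.

Lemma dotZl (R : realType) (d : nat) a (v w : 'rV[R]_d) : dot (a *: v) w = a * dot v w.
Proof. by rewrite !dotE -scalemxAl mxE. Qed.

Lemma col_mul (R : pzSemiRingType) (m p q : nat) (A : 'M[R]_(m, p)) (B : 'M[R]_(p, q)) k :
  col k (A *m B) = A *m col k B.
Proof. by rewrite !colE mulmxA. Qed.

Lemma metric_coef_gt0 (R : realType) (n : nat) : (0 < n)%N -> 0 < metric_coef R n.
Proof.
by move=> n0; rewrite divr_gt0 ?ltr0n // mulr_gt0 // exprn_gt0 // pi_gt0.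
Qed.

Lemma metric_coefMn (R : realType) (n : nat) :
  (0 < n)%N -> metric_coef R n * n%:R = 4 * pi ^+ 2.
Proof. by move=> n0; rewrite divfK // pnatr_eq0 -lt0n. Qed.

(** The metric coefficient times [n] is [4 * pi ^+ 2], so the eigenvalue [n] of the torus becomes
    this constant for the flat Laplacian in the coordinates [u]. *)
Lemma laplace_eigenspaceE (R : realType) (n : nat) (L : set 'rV[R]_n)
    (f : 'rV[R]_n -> R) :
  (0 < n)%N ->
  laplace_eigenspace L n%:R f <->
  [/\ smooth f, Defs.periodic L f &
      forall u, \sum_(i < n) partial i (partial i f) u = - (4 * pi ^+ 2) * f u].
Proof.
move=> n0; have c0 := metric_coef_gt0 R n0.
split=> -[sf pf ef]; split=> // u.
  move: (ef u); rewrite /laplacian -(metric_coefMn R n0) => E.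
  rewrite -[LHS](mulVKf (lt0r_neq0 c0)) -[_^-1 * _]opprK E; ring.
rewrite /laplacian ef -(metric_coefMn R n0); field; exact: lt0r_neq0.
Qed.

Lemma partial_dot_cst (R : realType) (n d : nat) (x y : 'rV[R]_n -> 'rV[R]_d)
    (a : R) (i : 'I_n) u :
  smooth x -> smooth y -> (forall u, dot (x u) (y u) = a) ->
  dot (partial i x u) (y u) = - dot (x u) (partial i y u).
Proof.
move=> sx sy xy; apply/eqP; rewrite -addr_eq0 -(partial_dot i u sx sy); apply/eqP.
rewrite (_ : (fun u => dot (x u) (y u)) = fun=> a); last by apply/funext.
exact: derive_cst.
Qed.

Lemma partial_commute_vec (R : realType) (n d : nat) (x : 'rV[R]_n -> 'rV[R]_d)
    (i j : 'I_n) : smooth x -> partial i (partial j x) = partial j (partial i x).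
Proof.
move=> sx; apply/funext => u; apply/rowP => k.
have /(congr1 (@^~ u)) := partial_commute i j (smooth_coord k sx).
by rewrite !partial_coord //; apply: smooth_partial.
Qed.

Lemma normal_part_sum (R : realType) (n d : nat) (x : 'rV[R]_n -> 'rV[R]_d) u
    (I : finType) (w : I -> 'rV[R]_d) :
  \sum_i normal_part x u (w i) = normal_part x u (\sum_i w i).
Proof.
rewrite /normal_part !big_split /= !sumrN; congr (_ - _ - _).
  by rewrite dot_suml scaler_suml.
rewrite -scaler_sumr; congr (_ *: _); rewrite exchange_big; apply: eq_bigr => j _.
by rewrite dot_suml scaler_suml.
Qed.

Lemma mean_curvatureE (R : realType) (n d : nat) (x : 'rV[R]_n -> 'rV[R]_d) u :
  mean_curvature x u = (n%:R * metric_coef R n)^-1 *: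
    normal_part x u (\sum_(i < n) partial i (partial i x) u).
Proof. by rewrite /mean_curvature -scaler_sumr scalerA [in RHS]invfM -normal_part_sum. Qed.

Lemma sphere_partial (R : realType) (n d : nat) (x : 'rV[R]_n -> 'rV[R]_d) i u :
  smooth x -> (forall u, sphere (x u)) -> dot (x u) (partial i x u) = 0.
Proof.
move=> sx x1; have := partial_dot_cst i u sx sx x1.
by rewrite [dot (partial _ _ _) _]dotC; lra.
Qed.

(** Vanishing mean curvature leaves only the components of the flat Laplacian along [x] and its
    partial derivatives. Differentiating the sphere condition gives the first; the others vanish
    because the metric coefficients are constant. *)
Lemma takahashi (R : realType) (n d : nat) (L : set 'rV[R]_n)
    (x : 'rV[R]_n -> 'rV[R]_d) u :
  (0 < n)%N -> minimal_isometric_immersion L x ->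
  \sum_(i < n) partial i (partial i x) u = - (4 * pi ^+ 2) *: x u.
Proof.
move=> n0 [sx px x1 ix mx]; have c0 := metric_coef_gt0 R n0.
have sdx i := smooth_partial i sx.
have Wx : dot (\sum_(i < n) partial i (partial i x) u) (x u) = - (4 * pi ^+ 2).
  rewrite dot_suml (eq_bigr (fun=> - metric_coef R n)) => [|i _].
    by rewrite sumr_const card_ord mulNrn -(metric_coefMn R n0) mulr_natr.
  rewrite (@partial_dot_cst _ _ _ (partial i x) x 0) ?ix ?eqxx ?mulr1n // => t.
  by rewrite dotC sphere_partial.
(* Each term equals minus the product of [partial i x] with [partial j (partial i x)], half the
   derivative of a constant squared length. *)
have Wdx j : dot (\sum_(i < n) partial i (partial i x) u) (partial j x u) = 0.
  rewrite dot_suml big1 // => i _.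
  rewrite (partial_dot_cst i u (sdx i) (sdx j) (fun t => ix t i j)).
  rewrite (partial_commute_vec i j sx).
  have := partial_dot_cst j u (sdx i) (sdx i) (fun t => ix t i i).
  by rewrite [X in X = _]dotC => E; lra.
have := mx u; rewrite mean_curvatureE => /eqP; rewrite scaler_eq0 invr_eq0.
rewrite mulf_eq0 pnatr_eq0 -[n == 0]negbK -lt0n n0 gt_eqF //= => /eqP.
rewrite /normal_part Wx [X in _ - _ - _ *: X]big1 => [|j _]; last by rewrite Wdx scale0r.
by rewrite scaler0 subr0 => /eqP; rewrite subr_eq0 => /eqP.
Qed.

(** Converse of Takahashi's theorem: a Laplacian proportional to the position vector has no normal
    part in the sphere. *)
Lemma minimal_isometric_immersion_of_eigen (R : realType) (n d : nat)
    (L : set 'rV[R]_n) (y : 'rV[R]_n -> 'rV[R]_d) (a : R) :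
  smooth y -> Defs.periodic L y -> (forall u, sphere (y u)) -> isometric y ->
  (forall u, \sum_(i < n) partial i (partial i y) u = a *: y u) ->
  minimal_isometric_immersion L y.
Proof.
move=> sy py y1 iy ey; split=> // u.
rewrite mean_curvatureE ey /normal_part dotZl (y1 u) mulr1 big1 => [|j _].
  by rewrite scaler0 subr0 subrr scaler0.
by rewrite dotZl sphere_partial // mulr0 scale0r.
Qed.

Lemma is_derive_mulmxr (R : realType) (n d q : nat) (e : 'rV[R]_n -> 'rV[R]_d)
    (A : 'M[R]_(d, q)) : smooth e ->
  smooth (fun u => e u *m A) /\
  forall i u, partial i (fun u => e u *m A) u = partial i e u *m A.
Proof.
move=> se.
have -> : (fun u => e u *m A) = fun u => \sum_(k < d) e u 0 k *: row k A.
  by apply/funext => u; rewrite mulmx_sum_row.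
split=> [|i u]; first by apply: smooth_comb => k; apply: smooth_coord.
rewrite partial_comb => [|k]; last exact: smooth_coord.
by rewrite mulmx_sum_row; apply: eq_bigr => k _; rewrite partial_coord.
Qed.

Lemma smooth_mulmxr (R : realType) (n d q : nat) (e : 'rV[R]_n -> 'rV[R]_d)
    (A : 'M[R]_(d, q)) : smooth e -> smooth (fun u => e u *m A).
Proof. by move=> /(is_derive_mulmxr A)[]. Qed.

Lemma partial_mulmxr (R : realType) (n d q : nat) (e : 'rV[R]_n -> 'rV[R]_d)
    (A : 'M[R]_(d, q)) i u :
  smooth e -> partial i (fun u => e u *m A) u = partial i e u *m A.
Proof. by move=> /(is_derive_mulmxr A)[]. Qed.

Lemma smooth_row (R : realType) (n d : nat) (f : 'I_d -> 'rV[R]_n -> R) :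
  (forall k, smooth (f k)) -> smooth (fun u => \row_k f k u).
Proof.
move=> sf.
have -> : (fun u => \row_k f k u) = fun u => \sum_(k < d) f k u *: delta_mx 0 k.
  apply/funext => u; rewrite [LHS]row_sum_delta.
  by apply: eq_bigr => k _; rewrite mxE.
exact: smooth_comb.
Qed.

(* [e u] lists the values at [u] of a basis of the eigenspace, in which [D i] is
   the matrix of [partial i]. *)
Definition eigenframe (R : realType) (n d : nat) (L : set 'rV[R]_n)
    (e : 'rV[R]_n -> 'rV[R]_d) (D : 'I_n -> 'M[R]_d) : Prop :=
  [/\ smooth e, Defs.periodic L e,
      forall i u, partial i e u = e u *m D i,
      forall c : 'cV[R]_d, (forall u, e u *m c = 0) -> c = 0 &
      \sum_(i < n) D i *m D i = - (4 * pi ^+ 2) *: 1%:M].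

Lemma eigenframe_inj (R : realType) (n d q : nat) (L : set 'rV[R]_n) e D
    (A B : 'M[R]_(d, q)) :
  eigenframe L e D -> (forall u, e u *m A = e u *m B) -> A = B.
Proof.
move=> [_ _ _ ei _] AB; apply/subr0_eq/trmx_inj/row_matrixP => k.
rewrite -tr_col linear0 linear0 (ei (col k (A - B))) ?linear0 // => u.
by rewrite -col_mul mulmxBr AB subrr linear0.
Qed.

Lemma eigenframe_commute (R : realType) (n d : nat) (L : set 'rV[R]_n)
    (e : 'rV[R]_n -> 'rV[R]_d) D i j :
  eigenframe L e D -> D i *m D j = D j *m D i.
Proof.
move=> fe; have [se _ de _ _] := fe; apply: (eigenframe_inj fe) => u.
have E k l : partial k (partial l e) u = e u *m (D k *m D l).
  rewrite (_ : partial l e = fun u => e u *m D l); last by apply/funext => t; apply: de.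
  by rewrite (partial_mulmxr (D l) k u se) de mulmxA.
by rewrite -!E (partial_commute_vec i j se).
Qed.

(** Partial derivatives commute with the Laplacian and preserve periodicity, hence act on the
    eigenspace; [D i] collects the coordinates of the derivatives of the basis. By Takahashi's
    theorem the coordinates of [x] lie in the eigenspace, whence the factor [A]. *)
Lemma exists_eigenframe (R : realType) (n d : nat) (L : set 'rV[R]_n) :
  (0 < n)%N -> has_dimension (laplace_eigenspace L n%:R) d ->
  exists (e : 'rV[R]_n -> 'rV[R]_d) (D : 'I_n -> 'M[R]_d),
    eigenframe L e D /\
    forall q (x : 'rV[R]_n -> 'rV[R]_q), minimal_isometric_immersion L x ->
      exists A : 'M[R]_(d, q), forall u, x u = e u *m A.
Proof.
move=> n0 [e0 [Ee span]]; pose e u := \row_k e0 k u.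
have se : smooth e by apply: smooth_row => k; case: (Ee k).
have pe : Defs.periodic L e.
  by move=> u v Lv; apply/rowP => k; rewrite !mxE; case: (Ee k) => _ ->.
(* Adding a linear relation [c] to the coordinates of a basis function yields a second expansion of
   it, against uniqueness. For [d = 0] there is no basis function, but the claim is empty. *)
have indep (c : 'cV[R]_d) : (forall u, e u *m c = 0) -> c = 0.
  move=> ec; case: (posnP d) => d0.
    by apply/colP => k; have := ltn_ord k; rewrite {2}d0.
  have [c1 [_ uniq]] := span _ (Ee (Ordinal d0)).
  pose k0 := Ordinal d0; pose v0 : 'rV[R]_d := delta_mx 0 k0.
  have f1 u : e0 k0 u = \sum_(k < d) v0 0 k * e0 k u.
    rewrite (bigD1 k0) //= big1 => [|k kk0]; first by rewrite mxE !eqxx mul1r addr0.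
    by rewrite mxE eqxx (negPf kk0) mul0r.
  have f2 u : e0 k0 u = \sum_(k < d) (v0 + c^T) 0 k * e0 k u.
    under eq_bigr do rewrite mxE mulrDl.
    rewrite big_split -f1 /= (_ : \sum_(k < d) c^T 0 k * e0 k u = (e u *m c) 0 0).
      by rewrite ec mxE addr0.
    by rewrite mxE; apply: eq_bigr => k _; rewrite !mxE mulrC.
  have := uniq _ f2; rewrite (uniq _ f1) -{1}[v0]addr0 => /addrI c0.
  by apply/trmx_inj; rewrite -c0 trmx0.
have coef (f : 'rV[R]_n -> R) : laplace_eigenspace L n%:R f ->
    exists c : 'cV[R]_d, forall u, f u = (e u *m c) 0 0.
  move=> /span[c [fc _]]; exists c^T => u; rewrite fc mxE.
  by apply: eq_bigr => k _; rewrite !mxE mulrC.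
have coefs q (f : 'I_q -> 'rV[R]_n -> R) :
    (forall k, laplace_eigenspace L n%:R (f k)) ->
    exists A : 'M[R]_(d, q), forall u, \row_k f k u = e u *m A.
  move=> Ef; have [c cE] := choice (fun k => coef _ (Ef k)).
  exists (\matrix_(i, j) c j i 0) => u; apply/rowP => k; rewrite !mxE cE mxE.
  by apply: eq_bigr => j _; rewrite !mxE.
have dE f i : laplace_eigenspace L n%:R f -> laplace_eigenspace L n%:R (partial i f).
  move=> /laplace_eigenspaceE -/(_ n0)[sf pf ef].
  apply/laplace_eigenspaceE => //; split.
  - exact: smooth_partial.
  - exact: periodic_partial.
  move=> u.
  (* Both sides of the eigenvalue equation are written as linear combinations, the right one with a
     single term, so that [partial_comb] differentiates them. *)
  have /(congr1 (fun g => partial i g u)) :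
      (fun u => \sum_(j < n) partial j (partial j f) u *: (1 : R)) =
      (fun u => \sum_(j < 1) f u *: (- (4 * pi ^+ 2) : R)).
    apply/funext => t; rewrite big_ord1 [RHS]mulrC -ef.
    by apply: eq_bigr => j _; rewrite /GRing.scale /= mulr1.
  rewrite !partial_comb => [|//|k]; last by do 2! apply: smooth_partial.
  rewrite big_ord1 /GRing.scale /= [RHS]mulrC => <-.
  apply: eq_bigr => j _; rewrite mulr1.
  by rewrite (partial_commute i j (smooth_partial j sf)) (partial_commute i j sf).
have [D DE] := choice (fun i => coefs _ _ (fun k => dE _ i (Ee k))).
have de i u : partial i e u = e u *m D i.
  rewrite -DE; apply/rowP => k; rewrite mxE.
  have -> : e0 k = (fun u => e u 0 k) by apply/funext => t; rewrite mxE.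
  by rewrite partial_coord.
exists e, D; split; last first.
  move=> q x mx; have [sx px _ _ _] := mx.
  have [k|A AE] := coefs q (fun k u => x u 0 k).
    apply/laplace_eigenspaceE => //; split; first exact: smooth_coord.
      by move=> u v Lv; rewrite px.
    move=> u; have /rowP/(_ k) := takahashi u n0 mx; rewrite !mxE summxE => <-.
    apply: eq_bigr => i _; rewrite !partial_coord //; exact: smooth_partial.
  by exists A => u; rewrite -AE; apply/rowP => k; rewrite mxE.
split=> //.
apply/subr0_eq; set M := _ - _; apply/trmx_inj/row_matrixP => k.
rewrite -tr_col linear0 linear0 (indep (col k M)) ?linear0 // => u.
rewrite -col_mul mulmxBr mulmx_sumr -scalemxAr mulmx1.
suff -> : \sum_(i < n) e u *m (D i *m D i) = - (4 * pi ^+ 2) *: e u.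
  by rewrite subrr linear0.
apply/rowP => l; rewrite summxE !mxE.
have /laplace_eigenspaceE -/(_ n0)[_ _ <-] := Ee l.
apply: eq_bigr => i _; rewrite mulmxA -de -partial_mulmxr //.
have -> : (fun u => e u *m D i) = partial i e by apply/funext => t; rewrite de.
have -> : e0 l = (fun u => e u 0 l) by apply/funext => t; rewrite mxE.
by rewrite !partial_coord //; apply: smooth_partial.
Qed.

(** * Periodicity and semisimplicity *)

Lemma perm_dup (T : eqType) (s : seq T) :
  ~~ uniq s -> exists r s', perm_eq s [:: r, r & s'].
Proof.
elim: s => //= x s IHs; rewrite negb_and negbK.
have [xs _|xs /= /IHs[r [s' ss']]] := boolP (x \in s).
  by exists x, (rem x s); rewrite perm_cons perm_to_rem.
exists r, (x :: s'); apply: (@perm_trans _ [:: x, r, r & s']).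
  by rewrite perm_cons.
by rewrite (perm_catCA [:: x] [:: r; r] s').
Qed.

(** If the minimal polynomial were [q * ('X - r) ^ 2], each row of [q(A)] together with its image
    under [A - r] would form a Jordan chain. The hypothesis kills that image, so [q * ('X - r)]
    annihilates [A], contradicting minimality. *)
Lemma semisimple_diagonalizable (C : numClosedFieldType) (n : nat) (A : 'M[C]_n) :
  (forall (a : C) (v w : 'rV[C]_n), v *m A = a *: v -> w *m A = a *: w + v -> v = 0) ->
  diagonalizable A.
Proof.
case: n A => [|n] A semi.
  by rewrite (_ : A = 0); [exact: diagonalizable0|apply/matrixP => -[]].
apply/diagonalizableP.
have [rs pE] := closed_field_poly_normal (mxminpoly A).
rewrite (monicP (mxminpoly_monic A)) scale1r in pE.
exists rs; last by rewrite pE.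
apply: contraT => /perm_dup[r [s pr]].
pose q := \prod_(x <- s) ('X - x%:P).
have {}pE : mxminpoly A = q * ('X - r%:P) * ('X - r%:P).
  by rewrite pE (perm_big _ pr) /= !big_cons -/q mulrA mulrC mulrA.
have XrE : horner_mx A ('X - r%:P) = A - r%:M.
  by rewrite rmorphB /= horner_mx_X horner_mx_C.
have : horner_mx A (q * ('X - r%:P)) = 0.
  apply/row_matrixP => k; rewrite linear0.
  apply: (semi r _ (row k (horner_mx A q))).
    have := mx_root_minpoly A; rewrite pE rmorphM /= XrE => /(congr1 (row k)).
    rewrite linear0 row_mul mulmxBr => /eqP; rewrite subr_eq0 => /eqP ->.
    by rewrite mul_mx_scalar.
  by rewrite rmorphM /= XrE row_mul mulmxBr mul_mx_scalar addrC subrK.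
move=> /mxminpoly_min /dvdp_leq.
have q0 : q * ('X - r%:P) != 0.
  by rewrite mulf_neq0 ?polyXsubC_eq0 // monic_neq0 // monic_prod_XsubC.
move=> /(_ q0); rewrite pE size_Mmonic ?monicXsubC // size_XsubC addn2 /=.
by rewrite ltnn.
Qed.

(** [q] is its initial value times [expR (a * t)], which is periodic only in the two listed
    cases. *)
Lemma periodic_growth (R : realType) (q : R -> R) (a : R) :
  (forall t : R, is_derive t 1 q (a * q t)) -> q 1 = q 0 -> a = 0 \/ q 0 = 0.
Proof.
move=> dq q10; pose h (t : R) := q t * expR (- a * t).
have dh (t : R) : is_derive t 1 h 0.
  have d1 : is_derive t 1 (fun t : R => expR (- a * t)) (expR (- a * t) * - a).
    apply: (@is_derive1_comp R expR (fun t => - a * t) t).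
    by apply: is_derive_eq; rewrite /GRing.scale /= mulr1.
  apply: is_derive_eq; rewrite /GRing.scale /=; ring.
have : h 1 = h 0 by apply: is_derive_0_is_cst.
rewrite /h mulr0 expR0 !mulr1 q10 => /eqP.
rewrite -subr_eq0 -[X in _ - X]mulr1 -mulrBr mulf_eq0 => /orP[/eqP|]; first by right.
rewrite subr_eq0 -expR0 => /eqP /expR_inj /eqP; rewrite oppr_eq0 => /eqP; by left.
Qed.

Lemma Re_map_mul (R : rcfType) (m p q : nat) (M : 'M[R]_(m, p)) (v : 'M[complex R]_(p, q)) :
  map_mx (@complex.Re R) (map_mx (real_complex R) M *m v) = M *m map_mx (@complex.Re R) v.
Proof.
apply/matrixP => i j; rewrite !mxE raddf_sum; apply: eq_bigr => k _; rewrite !mxE.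
by case: (v k j) => a b /=; rewrite mul0r subr0.
Qed.

Lemma Im_map_mul (R : rcfType) (m p q : nat) (M : 'M[R]_(m, p)) (v : 'M[complex R]_(p, q)) :
  map_mx (@complex.Im R) (map_mx (real_complex R) M *m v) = M *m map_mx (@complex.Im R) v.
Proof.
apply/matrixP => i j; rewrite !mxE raddf_sum; apply: eq_bigr => k _; rewrite !mxE.
by case: (v k j) => a b /=; rewrite mul0r addr0.
Qed.

Lemma Re_scale (R : rcfType) (m p : nat) a (v : 'M[complex R]_(m, p)) :
  map_mx (@complex.Re R) (a *: v) =
  complex.Re a *: map_mx (@complex.Re R) v - complex.Im a *: map_mx (@complex.Im R) v.
Proof. by apply/matrixP => i j; rewrite !mxE; case: a (v i j) => ? ? []. Qed.

Lemma Im_scale (R : rcfType) (m p : nat) a (v : 'M[complex R]_(m, p)) :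
  map_mx (@complex.Im R) (a *: v) =
  complex.Im a *: map_mx (@complex.Re R) v + complex.Re a *: map_mx (@complex.Im R) v.
Proof.
by apply/matrixP => i j; rewrite !mxE; case: a (v i j) => ? ? [] ? ? /=; rewrite addrC.
Qed.

Lemma ReIm_eq (R : rcfType) (m p : nat) (v w : 'M[complex R]_(m, p)) :
  map_mx (@complex.Re R) v = map_mx (@complex.Re R) w ->
  map_mx (@complex.Im R) v = map_mx (@complex.Im R) w -> v = w.
Proof.
move=> /matrixP vr /matrixP vi; apply/matrixP => i j; apply/eqP.
by move: (vr i j) (vi i j); rewrite !mxE eq_complex => -> ->; rewrite !eqxx.
Qed.

Lemma eigenframe_injC (R : realType) (n d q : nat) (L : set 'rV[R]_n) e D
    (A B : 'M[complex R]_(d, q)) :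
  eigenframe L e D ->
  (forall u, map_mx (real_complex R) (e u) *m A = map_mx (real_complex R) (e u) *m B) -> A = B.
Proof.
move=> fe AB; apply: ReIm_eq; apply: (eigenframe_inj fe) => u.
  by rewrite -!Re_map_mul AB.
by rewrite -!Im_map_mul AB.
Qed.

(** Matrix, in a frame, of the derivative along [v]. *)
Definition direction (R : realType) (n d : nat) (D : 'I_n -> 'M[R]_d) (v : 'rV[R]_n) :=
  \sum_i v 0 i *: D i.

Lemma is_derive_frame_line (R : realType) (n d : nat) (L : set 'rV[R]_n) e D
    (w : 'cV[R]_d) u v (t : R) : eigenframe L e D ->
  is_derive t 1 (fun s : R => (e (u + s *: v) *m w) 0 0)
    ((e (u + t *: v) *m (direction D v *m w)) 0 0).
Proof.
move=> [se _ de _ _]; pose f u := (e u *m w) 0 0.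
have sf : smooth (fun u => e u *m w) by apply: smooth_mulmxr.
have sf1 : smooth f by apply: (smooth_coord 0 sf).
have df := is_derive_line (smooth_differentiable (u + t *: v) sf1).
rewrite [X in is_derive _ _ _ X](_ : _ = 'D_v f (u + t *: v)) //.
rewrite derive_sum_partial; last exact: smooth_differentiable.
rewrite mulmx_suml mulmx_sumr summxE; apply: eq_bigr => i _.
rewrite /f (partial_coord 0 i sf) (partial_mulmxr w i _ se) de.
by rewrite -scalemxAl -scalemxAr mxE mulmxA.
Qed.

Lemma mx11_eq0 (R : pzSemiRingType) (A : 'M[R]_1) : A 0 0 = 0 -> A = 0.
Proof. by move=> A0; apply/matrixP => i j; rewrite !ord1 A0 mxE. Qed.

Lemma mul_rowD (R : pzRingType) (d : nat) (x : 'rV[R]_d) (v w : 'cV[R]_d) :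
  (x *m (v + w)) 0 0 = (x *m v) 0 0 + (x *m w) 0 0.
Proof. by rewrite mulmxDr mxE. Qed.

Lemma mul_rowZ (R : comPzRingType) (d : nat) (x : 'rV[R]_d) a (v : 'cV[R]_d) :
  (x *m (a *: v)) 0 0 = a * (x *m v) 0 0.
Proof. by rewrite -scalemxAr mxE. Qed.

(** The complex function [p1 + i p2] solves [p' = (a + i b) p], so its squared modulus grows at rate
    [2 * a]. *)
Lemma periodic_rotation (R : realType) (p1 p2 : R -> R) (a b : R) :
  (forall t : R, is_derive t 1 p1 (a * p1 t - b * p2 t)) ->
  (forall t : R, is_derive t 1 p2 (b * p1 t + a * p2 t)) ->
  p1 1 = p1 0 -> p2 1 = p2 0 -> a = 0 \/ p1 0 = 0 /\ p2 0 = 0.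
Proof.
move=> d1 d2 P1 P2; pose q : R -> R := p1 * p1 + p2 * p2.
have dq (t : R) : is_derive t 1 q ((2 * a) * q t).
  apply: is_derive_eq; rewrite -[q t]/(p1 t * p1 t + p2 t * p2 t) /GRing.scale /=; ring.
have q10 : q 1 = q 0 by rewrite -[q 1]/(p1 1 * p1 1 + p2 1 * p2 1) P1 P2.
case: (periodic_growth dq q10) => [/eqP|].
  by rewrite mulf_eq0 pnatr_eq0 => /eqP; left.
have -> : q 0 = p1 0 ^+ 2 + p2 0 ^+ 2 by rewrite !expr2.
move/eqP; rewrite paddr_eq0 ?sqr_ge0 // !sqrf_eq0.
by case/andP => /eqP -> /eqP ->; right.
Qed.

(** In complex notation [p' = i b p] and [r' = i b r + p]. Then the squared modulus of [p] is
    constant and is the derivative of the real inner product of [r] and [p]; this product grows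
    linearly, which periodicity forbids unless [p] vanishes. *)
Lemma periodic_resonance (R : realType) (p1 p2 r1 r2 : R -> R) (b : R) :
  (forall t : R, is_derive t 1 p1 (- b * p2 t)) ->
  (forall t : R, is_derive t 1 p2 (b * p1 t)) ->
  (forall t : R, is_derive t 1 r1 (- b * r2 t + p1 t)) ->
  (forall t : R, is_derive t 1 r2 (b * r1 t + p2 t)) ->
  p1 1 = p1 0 -> p2 1 = p2 0 -> r1 1 = r1 0 -> r2 1 = r2 0 -> p1 0 = 0 /\ p2 0 = 0.
Proof.
move=> d1 d2 c1 c2 P1 P2 P3 P4; pose q : R -> R := p1 * p1 + p2 * p2.
have dq (t : R) : is_derive t 1 q 0.
  by apply: is_derive_eq; rewrite /GRing.scale /=; ring.
have qc t : q t = q 0 by apply: is_derive_0_is_cst.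
pose p : R -> R := r1 * p1 + r2 * p2 - (fun t => q 0 * t).
have dp (t : R) : is_derive t 1 p 0.
  apply: is_derive_eq.
  rewrite -(qc t) -[q t]/(p1 t * p1 t + p2 t * p2 t) /GRing.scale /=; ring.
have p10 : p 1 = p 0 by apply: is_derive_0_is_cst.
have pE t : p t = r1 t * p1 t + r2 t * p2 t - (p1 0 ^+ 2 + p2 0 ^+ 2) * t.
  by rewrite !expr2.
have q0 : p1 0 ^+ 2 + p2 0 ^+ 2 = 0 by move: p10; rewrite !pE P1 P2 P3 P4; lra.
move/eqP: q0; rewrite paddr_eq0 ?sqr_ge0 // !sqrf_eq0.
by case/andP => /eqP -> /eqP ->.
Qed.

(** Along the period [b] the function attached to [v] grows like the exponential of the real part of
    [a], yet it has period 1. A nonzero real part would make it vanish on every such line, hence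
    [v = 0] by independence of the frame. *)
Lemma period_eigenvector (R : realType) (n d : nat) (L : set 'rV[R]_n) e D
    (b : 'rV[R]_n) (a : complex R) (v : 'cV[complex R]_d) :
  eigenframe L e D -> L b -> v != 0 ->
  map_mx (real_complex R) (direction D b) *m v = a *: v -> complex.Re a = 0.
Proof.
move=> fe Lb v0 va; apply: contraNeq v0 => a0; apply/eqP.
set M := direction D b in va.
set v1 := map_mx (@complex.Re R) v; set v2 := map_mx (@complex.Im R) v.
have M1 : M *m v1 = complex.Re a *: v1 - complex.Im a *: v2.
  by rewrite -Re_scale -va Re_map_mul.
have M2 : M *m v2 = complex.Im a *: v1 + complex.Re a *: v2.
  by rewrite -Im_scale -va Im_map_mul.
suff H u : (e u *m v1) 0 0 = 0 /\ (e u *m v2) 0 0 = 0.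
  by apply: ReIm_eq; apply: (eigenframe_inj fe) => u; rewrite map_mx0 mulmx0;
     apply: mx11_eq0; case: (H u).
pose p1 (t : R) := (e (u + t *: b) *m v1) 0 0.
pose p2 (t : R) := (e (u + t *: b) *m v2) 0 0.
have d1 (t : R) : is_derive t 1 p1 (complex.Re a * p1 t - complex.Im a * p2 t).
  have := is_derive_frame_line v1 u b t fe.
  by rewrite M1 mul_rowD -scaleNr !mul_rowZ mulNr.
have d2 (t : R) : is_derive t 1 p2 (complex.Im a * p1 t + complex.Re a * p2 t).
  have := is_derive_frame_line v2 u b t fe.
  by rewrite M2 mul_rowD !mul_rowZ.
have per t : e (u + (t + 1) *: b) = e (u + t *: b).
  by case: fe => _ pe _ _ _; rewrite scalerDl scale1r addrA (pe _ _ Lb).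
have P1 : p1 1 = p1 0 by rewrite /p1 -[1]add0r per.
have P2 : p2 1 = p2 0 by rewrite /p2 -[1]add0r per.
case: (periodic_rotation d1 d2 P1 P2) => [/eqP|]; first by rewrite (negPf a0).
by rewrite /p1 /p2 scale0r addr0.
Qed.

(** A Jordan chain would produce a function growing linearly along the period [b]. *)
Lemma period_semisimple (R : realType) (n d : nat) (L : set 'rV[R]_n) e D
    (b : 'rV[R]_n) (a : complex R) (v w : 'cV[complex R]_d) :
  eigenframe L e D -> L b ->
  map_mx (real_complex R) (direction D b) *m v = a *: v ->
  map_mx (real_complex R) (direction D b) *m w = a *: w + v -> v = 0.
Proof.
move=> fe Lb va wa; have [//|v0] := eqVneq v 0.
have a0 := period_eigenvector fe Lb v0 va.
set M := direction D b in va wa.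
set v1 := map_mx (@complex.Re R) v; set v2 := map_mx (@complex.Im R) v.
set w1 := map_mx (@complex.Re R) w; set w2 := map_mx (@complex.Im R) w.
have M1 : M *m v1 = - complex.Im a *: v2.
  by rewrite -Re_map_mul va Re_scale a0 scale0r add0r scaleNr.
have M2 : M *m v2 = complex.Im a *: v1.
  by rewrite -Im_map_mul va Im_scale a0 scale0r addr0.
have N1 : M *m w1 = - complex.Im a *: w2 + v1.
  by rewrite -Re_map_mul wa raddfD /= Re_scale a0 scale0r add0r scaleNr.
have N2 : M *m w2 = complex.Im a *: w1 + v2.
  by rewrite -Im_map_mul wa raddfD /= Im_scale a0 scale0r addr0.
suff H u : (e u *m v1) 0 0 = 0 /\ (e u *m v2) 0 0 = 0.
  by apply: ReIm_eq; apply: (eigenframe_inj fe) => u; rewrite map_mx0 mulmx0;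
     apply: mx11_eq0; case: (H u).
pose p1 (t : R) := (e (u + t *: b) *m v1) 0 0.
pose p2 (t : R) := (e (u + t *: b) *m v2) 0 0.
pose r1 (t : R) := (e (u + t *: b) *m w1) 0 0.
pose r2 (t : R) := (e (u + t *: b) *m w2) 0 0.
have d1 (t : R) : is_derive t 1 p1 (- complex.Im a * p2 t).
  by have := is_derive_frame_line v1 u b t fe; rewrite M1 mul_rowZ.
have d2 (t : R) : is_derive t 1 p2 (complex.Im a * p1 t).
  by have := is_derive_frame_line v2 u b t fe; rewrite M2 mul_rowZ.
have c1 (t : R) : is_derive t 1 r1 (- complex.Im a * r2 t + p1 t).
  by have := is_derive_frame_line w1 u b t fe; rewrite N1 mul_rowD mul_rowZ.
have c2 (t : R) : is_derive t 1 r2 (complex.Im a * r1 t + p2 t).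
  by have := is_derive_frame_line w2 u b t fe; rewrite N2 mul_rowD mul_rowZ.
have per t : e (u + (t + 1) *: b) = e (u + t *: b).
  by case: fe => _ pe _ _ _; rewrite scalerDl scale1r addrA (pe _ _ Lb).
have P1 : p1 1 = p1 0 by rewrite /p1 -[1]add0r per.
have P2 : p2 1 = p2 0 by rewrite /p2 -[1]add0r per.
have P3 : r1 1 = r1 0 by rewrite /r1 -[1]add0r per.
have P4 : r2 1 = r2 0 by rewrite /r2 -[1]add0r per.
have := periodic_resonance d1 d2 c1 c2 P1 P2 P3 P4.
by rewrite /p1 /p2 scale0r addr0.
Qed.

(** * Decomposition of the eigenspace into waves *)

Definition cexp (R : realType) (t : R) : complex R := Complex (cos t) (sin t).

Lemma directionE (R : realType) (n d : nat) (D : 'I_n -> 'M[R]_d) (B : 'M[R]_n) i :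
  B \in unitmx -> D i = \sum_j invmx B i j *: direction D (row j B).
Proof.
move=> uB; rewrite /direction.
under eq_bigr => j _ do rewrite scaler_sumr.
rewrite exchange_big /= (bigD1 i) //= [X in _ + X]big1 => [|k ki].
  rewrite addr0; under eq_bigr do rewrite mxE scalerA.
  rewrite -scaler_suml.
  have /matrixP/(_ i i) := mulVmx uB; rewrite !mxE eqxx => ->.
  by rewrite scale1r.
under eq_bigr do rewrite mxE scalerA.
rewrite -scaler_suml; have /matrixP/(_ i k) := mulVmx uB; rewrite !mxE => ->.
by rewrite eq_sym (negPf ki) scale0r.
Qed.

Lemma row_in_lattice (R : realType) (n : nat) (B : 'M[R]_n) j :
  [set v | exists z : 'rV[int]_n, v = map_mx (fun m : int => m%:~R) z *m B] (row j B).
Proof.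
exists (delta_mx 0 j); rewrite rowE; congr (_ *m _).
by apply/matrixP => i k; rewrite !mxE; case: (_ && _).
Qed.

(* Derivatives in the directions of a lattice basis are semisimple with imaginary
   eigenvalues, and every [D i] is a linear combination of them. *)
Lemma frame_joint_eigenbasis (R : realType) (n d : nat) (L : set 'rV[R]_n) e D :
  is_lattice L -> eigenframe L e D ->
  exists (P : 'M[complex R]_d) (eta : 'I_d -> 'rV[R]_n),
    P \in unitmx /\
    forall i k, map_mx (real_complex R) (D i) *m col k P = Complex 0 (eta k 0 i) *: col k P.
Proof.
move=> [B [uB LE]] fe.
have LB j : L (row j B) by rewrite LE; apply: row_in_lattice.
pose M j := map_mx (real_complex R) (direction D (row j B)).
have comm j l : M j *m M l = M l *m M j.
  rewrite -!map_mxM; congr map_mx; rewrite /direction !mulmx_suml.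
  under eq_bigr do rewrite mulmx_sumr.
  under [RHS]eq_bigr do rewrite mulmx_sumr.
  rewrite [RHS]exchange_big; apply: eq_bigr => i _; apply: eq_bigr => k _.
  by rewrite -!scalemxAl -!scalemxAr (eigenframe_commute i k fe) !scalerA mulrC.
(* Transposes appear because diagonalization is phrased for row vectors, whereas the frame
   multiplies columns. *)
have [|P uP /allP PM] := (codiagonalizableP [seq (M j)^T | j <- enum 'I_n]).1.
  split=> [_ _ /mapP[j _ ->] /mapP[l _ ->]|_ /mapP[j _ ->]].
    by rewrite /comm_mx -!trmx_mul comm.
  apply: semisimple_diagonalizable => a v w va wa.
  apply/trmx_inj; rewrite trmx0.
  apply: (period_semisimple fe (LB j) (a := a) (w := w^T)).
    by rewrite -/(M j) -[M j]trmxK -trmx_mul va linearZ.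
  by rewrite -/(M j) -[M j]trmxK -trmx_mul wa linearD linearZ.
have eig j k : exists a : R,
    M j *m col k P^T = Complex 0 a *: col k P^T.
  have /diagonalizable_forPex[dd /(simmxP uP) PE] := PM _ (map_f (fun j => (M j)^T) (mem_enum _ j)).
  have E : M j *m col k P^T = dd 0 k *: col k P^T.
    rewrite -!tr_row -[M j]trmxK -trmx_mul -row_mul PE row_diag_mul linearZ.
    by rewrite /= tr_row.
  have v0 : col k P^T != 0.
    rewrite -tr_row trmx_eq0; apply: contraTneq uP => P0.
    rewrite -row_free_unit -kermx_eq0; apply/negP => /eqP ker.
    have : ((delta_mx 0 k : 'rV_d) <= kermx P)%MS by apply/sub_kermxP; rewrite -rowE.
    rewrite ker submx0 => /eqP/matrixP/(_ 0 k)/eqP.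
    by rewrite !mxE !eqxx oner_eq0.
  exists (complex.Im (dd 0 k)); rewrite E; congr (_ *: _).
  by rewrite -(period_eigenvector fe (LB j) v0 E); case: (dd 0 k).
have [a aE] := choice (fun jk : 'I_n * 'I_d => eig jk.1 jk.2).
(* The frequencies [a] along the rows of the lattice basis [B] are converted to standard coordinates
   by [invmx B]. *)
exists P^T, (fun k => \row_i \sum_j invmx B i j * a (j, k)); split.
  by rewrite unitmx_tr.
move=> i k; rewrite (directionE D i uB).
have -> : map_mx (real_complex R) (\sum_j invmx B i j *: direction D (row j B)) =
   \sum_j real_complex R (invmx B i j) *: M j.
  by rewrite raddf_sum; apply: eq_bigr => j _; rewrite /= map_mxZ.
rewrite mulmx_suml.
have -> : Complex 0 ((\row_i0 \sum_j invmx B i0 j * a (j, k)) 0 i) =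
   \sum_j real_complex R (invmx B i j) * Complex 0 (a (j, k)).
  rewrite mxE; apply/eqP; rewrite eq_complex !raddf_sum /=; apply/andP; split.
    by rewrite big1 // => j _; rewrite mul0r mulr0 subr0.
  by apply/eqP; apply: eq_bigr => j _; rewrite mul0r addr0.
rewrite scaler_suml; apply: eq_bigr => j _.
by rewrite -scalemxAl (aE (j, k)) scalerA.
Qed.

(** Rotating the pair back by the angle [a * t] gives the constants [p] and [q]. *)
Lemma cexp_ode (R : realType) (f g : R -> R) (a : R) :
  (forall t : R, is_derive t 1 f (- a * g t)) ->
  (forall t : R, is_derive t 1 g (a * f t)) ->
  f 1 = f 0 * cos a - g 0 * sin a /\ g 1 = f 0 * sin a + g 0 * cos a.
Proof.
move=> df dg.
have dc (t : R) : is_derive t 1 (fun t => cos (a * t)) (- sin (a * t) * a).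
  apply: (@is_derive1_comp R cos (fun t => a * t) t).
  by apply: is_derive_eq; rewrite /GRing.scale /= mulr1.
have ds (t : R) : is_derive t 1 (fun t => sin (a * t)) (cos (a * t) * a).
  apply: (@is_derive1_comp R sin (fun t => a * t) t).
  by apply: is_derive_eq; rewrite /GRing.scale /= mulr1.
pose p (t : R) := f t * cos (a * t) + g t * sin (a * t).
pose q (t : R) := g t * cos (a * t) - f t * sin (a * t).
have dp (t : R) : is_derive t 1 p 0.
  by apply: is_derive_eq; rewrite /GRing.scale /=; ring.
have dq (t : R) : is_derive t 1 q 0.
  by apply: is_derive_eq; rewrite /GRing.scale /=; ring.
have : p 1 = p 0 by apply: is_derive_0_is_cst.
have : q 1 = q 0 by apply: is_derive_0_is_cst.
rewrite /p /q mulr0 mulr1 cos0 sin0 !mulr0 !mulr1 addr0 subr0 => <- <-.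
have := cos2Dsin2 a => cs; split.
  by rewrite -[LHS]mulr1 -cs; ring.
by rewrite -[LHS]mulr1 -cs; ring.
Qed.

Lemma frame_eigencolumn (R : realType) (n d : nat) (L : set 'rV[R]_n) e D
    (eta : 'rV[R]_n) (v : 'cV[complex R]_d) u :
  eigenframe L e D ->
  (forall i, map_mx (real_complex R) (D i) *m v = Complex 0 (eta 0 i) *: v) ->
  (map_mx (real_complex R) (e u) *m v) 0 0 =
  (map_mx (real_complex R) (e 0) *m v) 0 0 * cexp (dot eta u).
Proof.
move=> fe Dv.
pose v1 := map_mx (@complex.Re R) v; pose v2 := map_mx (@complex.Im R) v.
have DE : map_mx (real_complex R) (direction D u) *m v = Complex 0 (dot eta u) *: v.
  rewrite /direction raddf_sum mulmx_suml /=.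
  have -> : Complex 0 (dot eta u) = \sum_i real_complex R (u 0 i) * Complex 0 (eta 0 i).
    apply/eqP; rewrite eq_complex !raddf_sum /=; apply/andP; split.
      by rewrite big1 // => j _; rewrite mul0r mulr0 subr0.
    by apply/eqP; apply: eq_bigr => j _; rewrite mul0r addr0 mulrC.
  rewrite scaler_suml; apply: eq_bigr => i _.
  by rewrite map_mxZ -scalemxAl Dv scalerA.
have M1 : direction D u *m v1 = - dot eta u *: v2.
  by rewrite -Re_map_mul DE Re_scale /= scale0r add0r scaleNr.
have M2 : direction D u *m v2 = dot eta u *: v1.
  by rewrite -Im_map_mul DE Im_scale /= scale0r addr0.
have [t|t|E1 E2] := @cexp_ode R (fun t => (e (0 + t *: u) *m v1) 0 0)
    (fun t => (e (0 + t *: u) *m v2) 0 0) (dot eta u).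
- by have := is_derive_frame_line v1 0 u t fe; rewrite M1 mul_rowZ.
- by have := is_derive_frame_line v2 0 u t fe; rewrite M2 mul_rowZ.
move: E1 E2; rewrite add0r scale0r scale1r addr0 => E1 E2.
have split0 w : (map_mx (real_complex R) (e w) *m v) 0 0 =
    Complex ((e w *m v1) 0 0) ((e w *m v2) 0 0).
  rewrite -Re_map_mul -Im_map_mul !mxE; by case: (\sum_j _).
by rewrite !split0 E1 E2 /cexp; apply/eqP; rewrite eq_complex /= !eqxx.
Qed.

(** A joint eigencolumn gives a wave times its value at the origin. That value is nonzero by
    independence of the frame, so the columns can be normalized to pure waves. *)
Lemma frame_fourier (R : realType) (n d : nat) (L : set 'rV[R]_n) e D :
  is_lattice L -> eigenframe L e D ->
  exists (P : 'M[complex R]_d) (eta : 'I_d -> 'rV[R]_n),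
    [/\ P \in unitmx,
        forall u k, (map_mx (real_complex R) (e u) *m P) 0 k = cexp (dot (eta k) u),
        forall i, map_mx (real_complex R) (D i) *m P =
                  P *m diag_mx (\row_k Complex 0 (eta k 0 i)),
        injective eta &
        forall k, dot (eta k) (eta k) = 4 * pi ^+ 2].
Proof.
move=> lL fe; have [P0 [eta [uP0 P0E]]] := frame_joint_eigenbasis lL fe.
pose g k := (map_mx (real_complex R) (e 0) *m col k P0) 0 0.
have col_neq0 k : col k P0 != 0.
  apply/eqP => P00; have := mulVmx uP0 => /(congr1 (col k)).
  rewrite col_mul P00 mulmx0 => /colP/(_ k)/eqP.
  by rewrite !mxE eqxx eq_sym oner_eq0.
have g0 k : g k != 0.
  apply: contra (col_neq0 k) => /eqP gk; apply/eqP/(eigenframe_injC fe) => u.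
  rewrite mulmx0; apply: mx11_eq0.
  by rewrite (frame_eigencolumn u fe (P0E ^~ k)) -/(g k) gk mul0r.
pose r := \row_k (g k)^-1.
pose P := P0 *m diag_mx r.
have PE j k : P j k = (g k)^-1 * P0 j k by rewrite /P mul_mx_diag !mxE mulrC.
have colE k : col k P = (g k)^-1 *: col k P0.
  by apply/colP => i; rewrite [LHS]mxE PE 2!mxE.
have uP : P \in unitmx.
  rewrite unitmx_mul uP0 unitmxE det_diag unitfE; apply/prodf_neq0 => k _.
  by rewrite mxE invr_eq0.
have eP u k : (map_mx (real_complex R) (e u) *m P) 0 k = cexp (dot (eta k) u).
  transitivity ((map_mx (real_complex R) (e u) *m col k P) 0 0).
    by rewrite -col_mul [RHS]mxE.
  rewrite colE -scalemxAr mxE (frame_eigencolumn u fe (P0E ^~ k)) -/(g k).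
  by rewrite mulKf.
have DP i : map_mx (real_complex R) (D i) *m P = P *m diag_mx (\row_k Complex 0 (eta k 0 i)).
  apply/matrixP => j k; rewrite mul_mx_diag [RHS]mxE [(\row__ _) _ _]mxE.
  transitivity ((map_mx (real_complex R) (D i) *m col k P) j 0).
    by rewrite -col_mul [RHS]mxE.
  by rewrite colE -scalemxAr P0E scalerA PE mxE [col _ _ _ _]mxE mulrAC.
exists P, eta; split=> //.
(* Equal frequencies would give the same wave, hence two equal columns in the invertible matrix
   [P]. *)
- move=> k l kl; apply/eqP; apply: contraT => nkl.
  have Pkl : col k P = col l P.
    apply: (eigenframe_injC fe) => u; apply/matrixP => a b; rewrite !ord1 -!col_mul.
    by rewrite [LHS]mxE [RHS]mxE !eP kl.
  have := mulVmx uP => VP.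
  have := congr1 (col k) VP; rewrite col_mul Pkl -col_mul VP => /colP/(_ k)/eqP.
  by rewrite !mxE eqxx (negPf nkl) eq_sym oner_eq0.
(* The diagonal entries of the sum of the [D i *m D i], after conjugation by [P], are minus the
   squared lengths of the frequencies. *)
- move=> k; have [_ _ _ _ DD] := fe.
  have /(congr1 (fun M => map_mx (real_complex R) M *m P)) := DD.
  rewrite raddf_sum mulmx_suml.
  under eq_bigr => i _ do rewrite /= map_mxM -mulmxA DP mulmxA DP -mulmxA mulmx_diag.
  rewrite -mulmx_sumr map_mxZ map_mx1 -scalemxAl mul1mx -[X in _ *: X]mulmx1 scalemxAr.
  move/(congr1 (mulmx (invmx P))); rewrite !mulKmx // => /matrixP/(_ k k).
  rewrite summxE [in RHS]mxE [in RHS]mxE eqxx mulr1n mulr1.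
  move=> /(congr1 (@complex.Re R)); rewrite raddf_sum /= => /eqP.
  rewrite -eqr_opp opprK => /eqP <-; rewrite /dot -sumrN.
  apply: eq_bigr => i _; rewrite !mxE eqxx mulr1n /=; ring.
Qed.

(** * Mean values and conic combinations *)

Lemma cexpD (R : realType) (s t : R) : cexp (s + t) = cexp s * cexp t.
Proof.
apply/eqP; rewrite eq_complex /= cosD sinD; apply/andP; split=> //.
by rewrite addrC.
Qed.

Lemma cexp0 (R : realType) : cexp (0 : R) = 1.
Proof. by rewrite /cexp cos0 sin0. Qed.

Lemma cexp_conj (R : realType) (t : R) : conjc (cexp t) = cexp (- t).
Proof. by rewrite /cexp cosN sinN. Qed.

Lemma dotDr (R : realType) (d : nat) (v w z : 'rV[R]_d) : dot v (w + z) = dot v w + dot v z.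
Proof. by rewrite !(dotC v) !dotE mulmxDl mxE. Qed.

Lemma dotBl (R : realType) (d : nat) (v w z : 'rV[R]_d) : dot (v - w) z = dot v z - dot w z.
Proof. by rewrite !dotE mulmxBl !mxE. Qed.

(** Averaging two translates replaces an integral over the torus: it preserves the constant [c] and
    removes one oscillating wave, so induction on the number of such waves leaves the zero
    frequencies. *)
Lemma cexp_mean (R : realType) (n : nat) (J : finType) (w : J -> complex R)
    (omega : J -> 'rV[R]_n) (c : complex R) :
  (forall u, \sum_j w j * cexp (dot (omega j) u) = c) ->
  \sum_(j | omega j == 0) w j = c.
Proof.
have [m] := ubnP #|[pred j | (omega j != 0) && (w j != 0)]|.
elim: m w => // m IHm w /ltnSE wm wc.
have [j0 /andP[om0 w0]|ws] := fintype.pickP [pred j | (omega j != 0) && (w j != 0)]; last first.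
  rewrite -(wc 0) [RHS](bigID (fun j => omega j == 0)) /=.
  rewrite [X in _ = _ + X]big1 ?addr0 => [|j j0].
    by apply: eq_bigr => j _; rewrite dotE trmx0 mulmx0 mxE cexp0 mulr1.
  apply/eqP; rewrite mulf_eq0; apply/orP; left; apply: contraT => wj.
  by have := ws j; rewrite /= j0 wj.
have nz : sqnorm (omega j0) != 0 by rewrite sqnorm_eq0.
(* Translation by [v] advances the phase of the wave [j0] by [pi], that is, changes its sign. *)
pose v := (pi / sqnorm (omega j0)) *: omega j0.
have zj0 : cexp (dot (omega j0) v) = -1.
  rewrite dotC /v dotZl dotE -/(sqnorm _) divfK // /cexp cospi sinpi.
  by apply/eqP; rewrite eq_complex /= oppr0 !eqxx.
(* f |-> (f (u + v) + f u) / 2 fixes constants and kills the j0-th wave *)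
pose w' j := w j * (cexp (dot (omega j) v) + 1) / 2.
have two0 : (2 : complex R) != 0 by rewrite pnatr_eq0.
have w'E : \sum_(j | omega j == 0) w' j = \sum_(j | omega j == 0) w j.
  apply: eq_bigr => j /eqP oj; rewrite /w' oj dotE mul0mx mxE cexp0.
  by rewrite -[1 + 1]/(2 : complex R) mulfK.
rewrite -w'E; apply: IHm => [|u].
  apply: leq_trans wm; apply: proper_card; apply/fintype.properP; split.
    apply/fintype.subsetP => j; rewrite !inE => /andP[-> /=].
    by apply: contraNneq => wj; rewrite /w' wj !mul0r.
  by exists j0; rewrite !inE ?om0 ?w0 //= /w' zj0 addNr mulr0 mul0r eqxx.
transitivity ((c + c) / 2); last by rewrite -[c + c]mulr2n -[c *+ 2]mulr_natr mulfK.
rewrite -{1}(wc (u + v)) -(wc u) -big_split mulr_suml; apply: eq_bigr => j _ /=.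
by rewrite dotDr cexpD /w'; ring.
Qed.

(** While more than [#|J|] weights are nonzero, the corresponding vectors satisfy a linear relation;
    subtracting a suitable multiple of it kills a weight and keeps all others nonnegative. *)
Lemma conic_caratheodory (F : realFieldType) (I J : finType) (v : I -> J -> F)
    (a : I -> F) :
  (forall i, 0 <= a i) ->
  exists b : I -> F, [/\ forall i, 0 <= b i,
    forall j, \sum_i b i * v i j = \sum_i a i * v i j &
    (#|[pred i | b i != 0%R]| <= #|J|)%N].
Proof.
have [m] := ubnP #|[pred i | a i != 0]|.
elim: m a => // m IHm a /ltnSE am a0.
pose S := [pred i | a i != 0].
case: (leqP #|S| #|J|) => SJ; first by exists a.
pose V := \matrix_(p < #|S|, q < #|J|) v (enum_val p) (enum_val q).
have : kermx V != 0.
  by rewrite kermx_eq0 /row_free neq_ltn (leq_ltn_trans (rank_leq_col _)).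
case/rowV0Pn => r /sub_kermxP rV r0.
suff [y [yS y0 yV]] : exists y : I -> F,
    [/\ forall i, a i = 0 -> y i = 0, exists i, 0 < y i &
        forall j, \sum_i y i * v i j = 0].
  have [i0 yi0] := y0.
  (* The least ratio over the positive coefficients is the largest multiple of [y] that may be
     subtracted. *)
  case: (@Order.TotalTheory.arg_minP _ F I i0 (fun i => 0 < y i) (fun i => a i / y i) yi0).
  move=> i1 yi1 imin; set t := a i1 / y i1.
  have t0 : 0 <= t by rewrite divr_ge0 // ltW.
  have b0 i : 0 <= a i - t * y i.
    rewrite subr_ge0; case: (ltP 0 (y i)) => yi; last first.
      by rewrite (le_trans _ (a0 i)) // mulr_ge0_le0.
    by rewrite -ler_pdivlMr // imin.
  have [|b [bp bv bs]] := IHm (fun i => a i - t * y i) _ b0.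
    apply: leq_trans am; apply: proper_card; apply/fintype.properP; split.
      apply/fintype.subsetP => i; rewrite !inE; apply: contraNneq => ai.
      by rewrite ai yS // mulr0 subr0.
    exists i1; rewrite !inE; last by rewrite divfK ?subrr ?eqxx ?gt_eqF.
    by apply: contraTneq yi1 => /yS ->; rewrite ltxx.
  exists b; split=> // j; rewrite bv.
  under eq_bigr do rewrite mulrBl -mulrA.
  by rewrite sumrB -mulr_sumr yV mulr0 subr0.
pose y0 i := \sum_p r 0 p * (enum_val p == i)%:R.
have y0S i : a i = 0 -> y0 i = 0.
  move=> ai; rewrite /y0 big1 // => p _; case: eqP => [pi|]; last by rewrite mulr0.
  by have := enum_valP p; rewrite inE pi ai eqxx.
have y0V j : \sum_i y0 i * v i j = 0.
  under eq_bigr do rewrite mulr_suml.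
  rewrite exchange_big /=; transitivity ((r *m V) 0 (enum_rank j)).
    2: by rewrite rV mxE.
  rewrite mxE; apply: eq_bigr => p _; rewrite mxE enum_rankK (bigD1 (enum_val p)) //= eqxx mulr1.
  by rewrite big1 ?addr0 // => i ip; rewrite eq_sym (negPf ip) mulr0 mul0r.
have [p rp] : exists p, r 0 p != 0.
  apply/existsP; apply: contraNT r0; rewrite negb_exists => /forallP H.
  by apply/eqP/rowP => p; rewrite mxE; apply/eqP; have := H p; rewrite negbK.
have yp : y0 (enum_val p) = r 0 p.
  rewrite /y0 (bigD1 p) //= eqxx mulr1 big1 ?addr0 // => q qp.
  by rewrite (inj_eq enum_val_inj) (negPf qp) mulr0.
(* The relation is negated if needed, to ensure a positive coefficient. *)
case: (ltP 0 (r 0 p)) => rp0; first by exists y0; split=> //; exists (enum_val p); rewrite yp.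
exists (fun i => - y0 i); split=> [i ai||j].
- by rewrite y0S ?oppr0.
- by exists (enum_val p); rewrite yp oppr_gt0 lt_neqAle rp.
- by under eq_bigr do rewrite mulNr; rewrite sumrN y0V oppr0.
Qed.

(** The pairs with [i <= j] and those with [j <= i] together cover the square once and the diagonal
    once more. *)
Lemma card_ordered_pairs (n : nat) :
  (2 * #|{: {p : 'I_n * 'I_n | p.1 <= p.2}}| = n ^ 2 + n)%N.
Proof.
rewrite card_sig.
have -> : #|[pred p : 'I_n * 'I_n | p.1 <= p.2]%N| = (\sum_(i < n) \sum_(j < n) (i <= j))%N.
  by rewrite -sum1_card pair_big big_mkcond /=; apply: eq_bigr => p _; rewrite inE; case: ifP.
rewrite mul2n -addnn -{2}exchange_big -big_split /=.
rewrite (eq_bigr (fun=> (n + 1)%N)) => [|i _].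
  by rewrite sum_nat_const card_ord mulnDr muln1 mulnn.
rewrite -big_split /= (eq_bigr (fun j : 'I_n => (1 + (i == j))%N)) => [|j _].
  rewrite big_split /= sum_nat_const card_ord muln1 (bigD1 i) //= eqxx big1 //.
  by move=> j ji; rewrite eq_sym (negPf ji).
by rewrite -val_eqE /=; case: ltngtP.
Qed.

(** * Weights of the waves *)

Definition fourier_matrix (R : realType) (n d : nat) (e : 'rV[R]_n -> 'rV[R]_d)
    (D : 'I_n -> 'M[R]_d) (P : 'M[complex R]_d) (eta : 'I_d -> 'rV[R]_n) : Prop :=
  [/\ P \in unitmx,
      forall u k, (map_mx (real_complex R) (e u) *m P) 0 k = cexp (dot (eta k) u) &
      forall i, map_mx (real_complex R) (D i) *m P =
                P *m diag_mx (\row_k Complex 0 (eta k 0 i))].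

(** With [A = P Z] over the complex numbers, the weight [a k] is the squared norm of row [k] of [Z].
    The inner products of derivatives are constant, hence equal to their mean, to which only pairs
    of equal frequencies contribute. *)
Lemma isometric_weights (R : realType) (n d q : nat) e (D : 'I_n -> 'M[R]_d) P eta
    (A : 'M[R]_(d, q)) (c : R) :
  fourier_matrix e D P eta -> injective eta ->
  (forall u i j, dot (e u *m D i *m A) (e u *m D j *m A) = c *+ (i == j)) ->
  exists a : 'I_d -> R, (forall k, 0 <= a k) /\
    forall i j, \sum_k a k * (eta k 0 i * eta k 0 j) = c *+ (i == j).
Proof.
move=> [uP eP DP] eta_inj iso.
have [Z ZE] : exists Z, map_mx (real_complex R) A = P *m Z.
  by exists (invmx P *m map_mx (real_complex R) A); rewrite mulKVmx.
have row_wave u i l : real_complex R ((e u *m D i *m A) 0 l) =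
    \sum_k cexp (dot (eta k) u) * Complex 0 (eta k 0 i) * Z k l.
  transitivity ((map_mx (real_complex R) (e u *m D i *m A)) 0 l); first by rewrite [RHS]mxE.
  rewrite !map_mxM ZE.
  rewrite !mulmxA -[_ *m map_mx _ (D i) *m P]mulmxA DP mulmxA.
  rewrite mxE; apply: eq_bigr => k _; rewrite mul_mx_diag mxE eP [(\row__ _) _ _]mxE.
  by [].
(* A real entry equals its conjugate; expanding the second factor this way makes products of waves
   have frequencies [eta k - eta l]. *)
have row_waveJ u j l : real_complex R ((e u *m D j *m A) 0 l) =
    \sum_k cexp (- dot (eta k) u) * Complex 0 (- eta k 0 j) * conjc (Z k l).
  rewrite -[LHS]conjc_real row_wave raddf_sum; apply: eq_bigr => k _ /=.
  by rewrite !rmorphM /= -cexp_conj.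
pose w i j (p : 'I_d * 'I_d) := real_complex R (eta p.1 0 i * eta p.2 0 j) *
  \sum_l Z p.1 l * conjc (Z p.2 l).
have mean i j : \sum_k w i j (k, k) = real_complex R (c *+ (i == j)).
  rewrite -(@cexp_mean R n _ (w i j) (fun p => eta p.1 - eta p.2)
    (real_complex R (c *+ (i == j)))) => [|u].
    rewrite (eq_bigl (fun p => p.1 == p.2)) => [|p].
      rewrite [RHS]big_mkcond.
      transitivity (\sum_k \sum_l (if k == l then w i j (k, l) else 0)).
        apply: eq_bigr => k _; rewrite -big_mkcond /=.
        by under eq_bigl do rewrite eq_sym; rewrite big_pred1_eq.
      by rewrite pair_bigA; apply: eq_bigr => -[].
    by rewrite subr_eq0 (inj_eq eta_inj).
  rewrite -(iso u) [X in real_complex _ X]/dot raddf_sum.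
  transitivity (\sum_(l < q) (\sum_k cexp (dot (eta k) u) * Complex 0 (eta k 0 i) * Z k l) *
     (\sum_k cexp (- dot (eta k) u) * Complex 0 (- eta k 0 j) * conjc (Z k l))); last first.
    by apply: eq_bigr => l _; rewrite -row_wave -row_waveJ -rmorphM.
  under [RHS]eq_bigr => l _ do rewrite mulr_suml.
  under [RHS]eq_bigr => l _ do under eq_bigr => k _ do rewrite mulr_sumr.
  rewrite [RHS]exchange_big /=.
  under [RHS]eq_bigr => k _ do rewrite exchange_big /=.
  rewrite pair_bigA; apply: eq_bigr => -[k m] _ /=.
  rewrite /w /= mulr_sumr mulr_suml; apply: eq_bigr => l _.
  rewrite dotBl cexpD.
  have -> : real_complex R (eta k 0 i * eta m 0 j) =
     Complex 0 (eta k 0 i) * Complex 0 (- eta m 0 j).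
    by apply/eqP; rewrite eq_complex /=; apply/andP; split; apply/eqP; ring.
  ring.
exists (fun k => \sum_l (complex.Re (Z k l) ^+ 2 + complex.Im (Z k l) ^+ 2)); split.
  by move=> k; apply: sumr_ge0 => l _; rewrite addr_ge0 ?sqr_ge0.
move=> i j; have /(congr1 (@complex.Re R)) := mean i j => /= <-.
rewrite raddf_sum; apply: eq_bigr => k _; rewrite /w /=.
have -> : \sum_l Z k l * conjc (Z k l) =
    real_complex R (\sum_l (complex.Re (Z k l) ^+ 2 + complex.Im (Z k l) ^+ 2)).
  rewrite raddf_sum; apply: eq_bigr => l _; case: (Z k l) => x y.
  by apply/eqP; rewrite eq_complex /=; apply/andP; split; apply/eqP; ring.
rewrite /= mulr0 subr0; ring.
Qed.

(** Pairs [i <= j] index the independent entries of a symmetric matrix. The factor 2 anticipates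
    that each weight uses a cosine and a sine column. *)
Lemma few_weights (R : realType) (n d : nat) (eta : 'I_d -> 'rV[R]_n) (c : R)
    (a : 'I_d -> R) :
  (forall k, 0 <= a k) ->
  (forall i j, \sum_k a k * (eta k 0 i * eta k 0 j) = c *+ (i == j)) ->
  exists b : 'I_d -> R, [/\ forall k, 0 <= b k,
    forall i j, \sum_k b k * (eta k 0 i * eta k 0 j) = c *+ (i == j) &
    (2 * #|[pred k | b k != 0%R]| <= n ^ 2 + n)%N].
Proof.
move=> a0 aE.
have [b [b0 bE bs]] := @conic_caratheodory R _ {: {p : 'I_n * 'I_n | (p.1 <= p.2)%N}}
  (fun k p => eta k 0 (sval p).1 * eta k 0 (sval p).2) a a0.
exists b; split=> // [i j|]; last first.
  by rewrite -card_ordered_pairs leq_pmul2l.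
wlog ij : i j / (i <= j)%N.
  move=> W; case: (leqP i j) => [|/ltnW] ij; first exact: W.
  rewrite eq_sym -W //; apply: eq_bigr => k _; by rewrite [eta k 0 i * _]mulrC.
by rewrite -aE; apply: (bE (exist _ (i, j) ij)).
Qed.

(** Only columns of nonzero weight are kept, so that the number of columns bounds the rank. *)
Definition scaled_columns (R : rcfType) (d : nat) (b : 'I_d -> R) (M : 'M[R]_d) :
    'M[R]_(d, #|[pred k | b k != 0]|) :=
  \matrix_(i, p) (Num.sqrt (b (enum_val p)) * M i (enum_val p)).

Lemma scaled_columns_gram (R : rcfType) (d : nat) (b : 'I_d -> R) (M : 'M[R]_d)
    (x y : 'rV[R]_d) :
  (forall k, 0 <= b k) ->
  (x *m scaled_columns b M *m (y *m scaled_columns b M)^T) 0 0 =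
  \sum_k b k * ((x *m M) 0 k * (y *m M) 0 k).
Proof.
move=> b0; pose F k := b k * ((x *m M) 0 k * (y *m M) 0 k).
have entry (z : 'rV[R]_d) p : (z *m scaled_columns b M) 0 p =
    Num.sqrt (b (enum_val p)) * (z *m M) 0 (enum_val p).
  rewrite !mxE mulr_sumr; apply: eq_bigr => i _; rewrite mxE; ring.
transitivity (\sum_(k in [pred k | b k != 0]) F k).
  rewrite big_enum_val mxE; apply: eq_bigr => p _; rewrite [_^T _ _]mxE !entry /F.
  rewrite -{3}[b (enum_val p)]sqr_sqrtr //; ring.
rewrite [RHS](bigID (mem [pred k | b k != 0])) /= [X in _ = _ + X]big1 ?addr0 //.
by move=> k; rewrite negbK => /eqP ->; rewrite mul0r.
Qed.

Lemma fourier_cos (R : realType) (n d : nat) e (D : 'I_n -> 'M[R]_d) P eta u k :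
  fourier_matrix e D P eta ->
  (e u *m map_mx (@complex.Re R) P) 0 k = cos (dot (eta k) u).
Proof. by case=> _ eP _; rewrite -Re_map_mul mxE eP. Qed.

Lemma fourier_sin (R : realType) (n d : nat) e (D : 'I_n -> 'M[R]_d) P eta u k :
  fourier_matrix e D P eta ->
  (e u *m map_mx (@complex.Im R) P) 0 k = sin (dot (eta k) u).
Proof. by case=> _ eP _; rewrite -Im_map_mul mxE eP. Qed.

Lemma fourier_partial (R : realType) (n d : nat) e (D : 'I_n -> 'M[R]_d) P eta i u k :
  fourier_matrix e D P eta ->
  (map_mx (real_complex R) (e u *m D i) *m P) 0 k =
  cexp (dot (eta k) u) * Complex 0 (eta k 0 i).
Proof.
case=> _ eP DP.
by rewrite map_mxM -mulmxA DP mulmxA mul_mx_diag mxE eP [(\row__ _) _ _]mxE.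
Qed.

Lemma fourier_partial_cos (R : realType) (n d : nat) e (D : 'I_n -> 'M[R]_d) P eta i u k :
  fourier_matrix e D P eta ->
  (e u *m D i *m map_mx (@complex.Re R) P) 0 k = - eta k 0 i * sin (dot (eta k) u).
Proof.
by move=> fP; rewrite -Re_map_mul mxE (fourier_partial _ _ _ fP) /= mulr0 sub0r mulrC mulNr.
Qed.

Lemma fourier_partial_sin (R : realType) (n d : nat) e (D : 'I_n -> 'M[R]_d) P eta i u k :
  fourier_matrix e D P eta ->
  (e u *m D i *m map_mx (@complex.Im R) P) 0 k = eta k 0 i * cos (dot (eta k) u).
Proof.
by move=> fP; rewrite -Im_map_mul mxE (fourier_partial _ _ _ fP) /= mulr0 addr0 mulrC.
Qed.

(** For a Fourier matrix [P], multiplying the frame by this matrix gives the cosines and sines of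
    the waves, scaled by the square roots of the weights. *)
Definition wave_matrix (R : rcfType) (d : nat) (P : 'M[complex R]_d) (b : 'I_d -> R) :=
  row_mx (scaled_columns b (map_mx (@complex.Re R) P))
         (scaled_columns b (map_mx (@complex.Im R) P)).

Lemma wave_gram (R : realType) (d : nat) (P : 'M[complex R]_d) (b : 'I_d -> R)
    (x y : 'rV[R]_d) :
  let Pc := map_mx (@complex.Re R) P in let Ps := map_mx (@complex.Im R) P in
  (forall k, 0 <= b k) ->
  dot (x *m wave_matrix P b) (y *m wave_matrix P b) =
  \sum_k b k * ((x *m Pc) 0 k * (y *m Pc) 0 k + (x *m Ps) 0 k * (y *m Ps) 0 k).
Proof.
move=> Pc Ps b0; rewrite dotE !mul_mx_row tr_row_mx mul_row_col mxE.
rewrite !scaled_columns_gram // -big_split; apply: eq_bigr => k _.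
by rewrite mulrDr.
Qed.

(** * The homotopy *)

Lemma continuous_sum (R : numFieldType) (V : normedModType R) (T : topologicalType)
    (I : Type) (s : seq I) (F : I -> T -> V) :
  (forall i, continuous (F i)) -> continuous (fun t => \sum_(i <- s) F i t).
Proof.
move=> Fc; elim: s => [|i s IHs] t.
  rewrite (_ : (fun t => _) = cst 0); first exact: cst_continuous.
  by apply/funext => u; rewrite big_nil.
rewrite (_ : (fun t => _) = F i \+ (fun t => \sum_(i <- s) F i t)).
  by apply: continuousD; [exact: Fc|exact: IHs].
by apply/funext => u; rewrite big_cons.
Qed.

Lemma continuous_path (R : realType) (n d : nat) (e : 'rV[R]_n -> 'rV[R]_d)
    (K Q : 'M[R]_d) (a b : 'rV[R]_d) :
  smooth e ->
  continuous (fun tu : R * 'rV[R]_n => e tu.2 *m (K *m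
    diag_mx (map_mx Num.sqrt ((1 - tu.1) *: a + tu.1 *: b)) *m Q)).
Proof.
move=> se.
have -> : (fun tu : R * 'rV[R]_n => e tu.2 *m (K *m
    diag_mx (map_mx Num.sqrt ((1 - tu.1) *: a + tu.1 *: b)) *m Q)) =
  (fun tu => \sum_(k < d) ((e tu.2 *m K) 0 k *
     Num.sqrt ((1 - tu.1) * a 0 k + tu.1 * b 0 k)) *: row k Q).
  apply/funext => tu; rewrite !mulmxA mulmx_sum_row; apply: eq_bigr => k _.
  by rewrite mul_mx_diag !mxE.
apply: continuous_sum => k tu.
apply: (@continuous_comp _ _ _ (fun tu : R * 'rV[R]_n => (e tu.2 *m K) 0 k *
     Num.sqrt ((1 - tu.1) * a 0 k + tu.1 * b 0 k)) ( *:%R^~ (row k Q)));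
  last exact: scalel_continuous.
have fst_c : {for tu, continuous (fun tu : R * 'rV[R]_n => tu.1)} by exact: cvg_fst.
apply: (@continuousM R _ (fun tu : R * 'rV[R]_n => (e tu.2 *m K) 0 k)).
  apply: (@continuous_comp _ _ _ (fun tu : R * 'rV[R]_n => tu.2)
    (fun u => (e u *m K) 0 k)); first exact: cvg_snd.
  apply: differentiable_continuous; apply: smooth_differentiable.
  by apply: smooth_coord; apply: smooth_mulmxr.
apply: (@continuous_comp _ _ _ (fun tu : R * 'rV[R]_n =>
   (1 - tu.1) * a 0 k + tu.1 * b 0 k) Num.sqrt); last exact: sqrt_continuous.
have cc (c : R) : {for tu, continuous (fun _ : R * 'rV[R]_n => c)} by exact: cst_continuous.
apply: (@continuousD R R^o _ (fun tu : R * 'rV[R]_n => (1 - tu.1) * a 0 k)).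
  apply: (@continuousM R _ (fun tu : R * 'rV[R]_n => 1 - tu.1)); last exact: cc.
  exact: (@continuousB R R^o _ (fun _ : R * 'rV[R]_n => 1) _ tu (cc 1) fst_c).
by apply: (@continuousM R _ (fun tu : R * 'rV[R]_n => tu.1)).
Qed.

(** * Rank, immersion conditions and homogeneity through Gram matrices *)

Lemma gram_eq0 (R : realFieldType) (m d : nat) (A : 'M[R]_(m, d)) :
  A *m A^T = 0 -> A = 0.
Proof.
move=> AA; apply/row_matrixP => i; rewrite row0; apply/eqP.
by rewrite -sqnorm_eq0 /sqnorm -gram_entry AA mxE.
Qed.

Lemma rank_gram_le (R : realFieldType) (d p q : nat) (A : 'M[R]_(d, p)) (B : 'M[R]_(d, q)) :
  A *m A^T = B *m B^T -> (\rank A <= \rank B)%N.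
Proof.
move=> AB; have : (kermx B <= kermx A)%MS.
  apply/sub_kermxP/gram_eq0; rewrite trmx_mul mulmxA -[_ *m A *m _]mulmxA AB.
  by rewrite mulmxA mulmx_ker !mul0mx.
move/mxrankS; rewrite !mxrank_ker => H.
by have := leq_sub2l d H; rewrite !subKn ?rank_leq_row.
Qed.

Lemma row_space_great_sphere (R : realType) (d k : nat) (A : 'M[R]_(d, k)) :
  A != 0 -> exists C, is_great_sphere (\rank A).-1 C /\
    forall y : 'rV[R]_k, sphere y -> (y <= A)%MS -> C y.
Proof.
rewrite -mxrank_eq0; have := eq_row_base A; have := row_base_free A.
move: (row_base A); case: (\rank A) => // r V fV eV _.
exists [set y | sphere y /\ (y <= V)%MS]; split; first by exists V.
by move=> y y1 yA; split=> //; rewrite eV.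
Qed.

(* For [M = A *m A^T], the conditions on [e *m A]; they are affine in [M]. *)
Definition gram_condition (R : realType) (n d : nat) (e : 'rV[R]_n -> 'rV[R]_d)
    (D : 'I_n -> 'M[R]_d) (M : 'M[R]_d) : Prop :=
  (forall u, (e u *m M *m (e u)^T) 0 0 = 1) /\
  (forall u i j, (e u *m D i *m M *m (e u *m D j)^T) 0 0 = metric_coef R n *+ (i == j)).

Lemma gram_dot (R : realType) (d q : nat) (A : 'M[R]_(d, q)) (x y : 'rV[R]_d) :
  dot (x *m A) (y *m A) = (x *m (A *m A^T) *m y^T) 0 0.
Proof. by rewrite dotE trmx_mul !mulmxA. Qed.

(** Minimality is automatic for [e *m A]: the sum of the [D i *m D i] is scalar, so the converse of
    Takahashi's theorem applies once the sphere and metric conditions hold. *)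
Lemma gram_conditionP (R : realType) (n d q : nat) (L : set 'rV[R]_n) e D
    (A : 'M[R]_(d, q)) :
  (0 < n)%N -> eigenframe L e D ->
  gram_condition e D (A *m A^T) <-> minimal_isometric_immersion L (fun u => e u *m A).
Proof.
move=> n0 [se pe de _ DD].
have dA i : partial i (fun u => e u *m A) = fun u => e u *m D i *m A.
  by apply/funext => u; rewrite (partial_mulmxr A i u se) de.
split=> [[M1 Mc]|[sA pA A1 iA _]]; last first.
  split=> [u|u i j]; rewrite -gram_dot; first exact: A1.
  by rewrite -(iA u) !dA.
apply: (@minimal_isometric_immersion_of_eigen _ _ _ _ _ (- (4 * pi ^+ 2))).
- exact: smooth_mulmxr.
- by move=> u v Lv; rewrite (pe _ _ Lv).
- by move=> u; rewrite /sphere /= gram_dot.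
- by move=> u i j; rewrite !dA gram_dot.
- move=> u; under eq_bigr => i _.
    rewrite dA.
    have -> : (fun u => e u *m D i *m A) = fun u => e u *m (D i *m A).
      by apply/funext => v; rewrite mulmxA.
    rewrite (partial_mulmxr _ i u se) de mulmxA -[_ *m D i *m D i]mulmxA -mulmxA.
    over.
  by rewrite -mulmx_sumr -mulmx_suml DD -scalemxAl mul1mx -scalemxAr.
Qed.

Lemma gram_condition_convex (R : realType) (n d : nat) (e : 'rV[R]_n -> 'rV[R]_d) D
    (M N : 'M[R]_d) t :
  gram_condition e D M -> gram_condition e D N ->
  gram_condition e D ((1 - t) *: M + t *: N).
Proof.
move=> [M1 Mc] [N1 Nc].
have lin (x y : 'rV[R]_d) : (x *m ((1 - t) *: M + t *: N) *m y^T) 0 0 =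
    (1 - t) * (x *m M *m y^T) 0 0 + t * (x *m N *m y^T) 0 0.
  by rewrite mulmxDr mulmxDl -!scalemxAr -!scalemxAl !mxE.
split=> [u|u i j]; rewrite lin ?M1 ?N1 ?Mc ?Nc; ring.
Qed.

(** The squared norm is the sum of the weights; since all frequencies have the same length, the
    trace of the weight equation makes this sum 1. *)
Lemma wave_gram_condition (R : realType) (n d : nat) (e : 'rV[R]_n -> 'rV[R]_d) D P eta
    (b : 'I_d -> R) :
  (0 < n)%N -> fourier_matrix e D P eta ->
  (forall k, dot (eta k) (eta k) = 4 * pi ^+ 2) ->
  (forall k, 0 <= b k) ->
  (forall i j, \sum_k b k * (eta k 0 i * eta k 0 j) = metric_coef R n *+ (i == j)) ->
  gram_condition e D (wave_matrix P b *m (wave_matrix P b)^T).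
Proof.
move=> n0 fP eta2 b0 bE; split=> [u|u i j]; rewrite -gram_dot wave_gram //.
  under eq_bigr => k _ do
    rewrite (fourier_cos _ _ fP) (fourier_sin _ _ fP) -!expr2 cos2Dsin2 mulr1.
  have pi2 : 4 * pi ^+ 2 != 0 :> R.
    by rewrite mulf_neq0 ?pnatr_eq0 // expf_neq0 // gt_eqF // pi_gt0.
  apply: (mulfI pi2); rewrite mulr1 -[RHS](metric_coefMn R n0) mulr_sumr.
  transitivity (\sum_i \sum_k b k * (eta k 0 i * eta k 0 i)).
    rewrite exchange_big; apply: eq_bigr => k _ /=.
    by rewrite -mulr_sumr -/(dot (eta k) (eta k)) eta2 mulrC.
  under eq_bigr do rewrite bE eqxx mulr1n.
  by rewrite sumr_const card_ord mulr_natr.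
rewrite -bE; apply: eq_bigr => k _; congr (_ * _).
rewrite !(fourier_partial_cos _ _ _ fP) !(fourier_partial_sin _ _ _ fP).
rewrite -[RHS]mulr1 -(cos2Dsin2 (dot (eta k) u)); ring.
Qed.

Lemma frame_translation (R : realType) (n d : nat) (e : 'rV[R]_n -> 'rV[R]_d) D P eta w :
  fourier_matrix e D P eta ->
  exists T : 'M[R]_d, forall u, e (u + w) = e u *m T.
Proof.
move=> [uP eP _].
pose T := P *m diag_mx (\row_k cexp (dot (eta k) w)) *m invmx P.
exists (map_mx (@complex.Re R) T) => u.
rewrite -Re_map_mul.
suff -> : map_mx (real_complex R) (e u) *m T = map_mx (real_complex R) (e (u + w)).
  by apply/rowP => k; rewrite !mxE.
apply: (can_inj (mulmxK uP)); rewrite /T !mulmxA mulmxKV //.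
apply/rowP => k; rewrite mul_mx_diag mxE !eP mxE.
by rewrite dotDr cexpD.
Qed.

(** Inner products of two points of the image are sums of cosines of phase differences, invariant
    under translation. Each translation is therefore induced by an orthogonal matrix, and the image
    is an orbit of such matrices. *)
Lemma wave_homogeneous (R : realType) (n d : nat) (L : set 'rV[R]_n) e D P eta
    (b : 'I_d -> R) (A : 'M[R]_d) :
  eigenframe L e D -> fourier_matrix e D P eta -> (forall k, 0 <= b k) ->
  A *m A^T = wave_matrix P b *m (wave_matrix P b)^T ->
  homogeneous (fun u => e u *m A).
Proof.
move=> fe fP b0 AB.
have trans w : exists Q : 'M[R]_d, Q *m Q^T = 1%:M /\
    forall u, e (u + w) *m A = e u *m A *m Q.
  have [T eT] := frame_translation w fP.
  have inv u v : dot (e (u + w) *m A) (e (v + w) *m A) = dot (e u *m A) (e v *m A).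
    rewrite !gram_dot AB -!gram_dot !wave_gram //; apply: eq_bigr => k _; congr (_ * _).
    rewrite !(fourier_cos _ _ fP) !(fourier_sin _ _ fP) !dotDr !cosD !sinD.
    rewrite -[RHS]mulr1 -(cos2Dsin2 (dot (eta k) w)); ring.
  have [|Q [QQ QA]] := @orthogonal_extension R d d A (T *m A).
    (* Two matrices agree once they agree as bilinear forms on the values of the frame. *)
    apply: (eigenframe_inj fe) => u; apply: trmx_inj.
    apply: (eigenframe_inj fe) => v; apply: trmx_inj; rewrite !trmx_mul !trmxK.
    have := inv u v; rewrite !eT !dotE !trmx_mul -!mulmxA => E.
    by apply/matrixP => i j; rewrite !ord1 E.
  by exists Q; split=> // u; rewrite eT -!mulmxA QA.
exists [set Q | Q *m Q^T = 1%:M /\ exists w, forall u, e (u + w) *m A = e u *m A *m Q].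
exists (e 0 *m A); split; first split.
- by move=> Q [].
- by split; [rewrite trmx1 mulmx1|exists 0 => u; rewrite addr0 mulmx1].
- move=> Q1 Q2 [QQ1 [w1 H1]] [QQ2 [w2 H2]]; split.
    by rewrite trmx_mul mulmxA -[Q1 *m Q2 *m _]mulmxA QQ2 mulmx1.
  by exists (w1 + w2) => u; rewrite addrA H2 H1 mulmxA.
- move=> Q [QQ [w H]].
  have [uQ _] := mulmx1_unit QQ.
  have QE : invmx Q = Q^T by rewrite -[LHS]mulmx1 -QQ mulKmx.
  split; first by rewrite QE trmxK; apply: mulmx1C.
  by exists (- w) => u; rewrite -{2}[u](subrK w) H mulmxK.
apply/seteqP; split=> [_ [w _ <-]|_ [Q [_ [w H]] <-]].
  have [Q [QQ H]] := trans w; exists Q; last by rewrite -H add0r.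
  by split=> //; exists w.
by exists w => //; rewrite -H add0r.
Qed.

Theorem theorem3 (R : realType) (n N : nat) (L : set 'rV[R]_n)
    (x : 'rV[R]_n -> 'rV[R]_(2 * N)) :
  (0 < n)%N ->
  is_lattice L ->
  has_dimension (laplace_eigenspace L n%:R) (2 * N) ->
  minimal_isometric_immersion L x ->
  exists (H : R -> 'rV[R]_n -> 'rV[R]_(2 * N)) (y : 'rV[R]_n -> 'rV[R]_(2 * N)),
    [/\ minimal_isometric_homotopy L H x y,
        homogeneous y &
        exists (p : nat) (C : set 'rV[R]_(2 * N)),
          [/\ (p < n ^ 2 + n)%N, is_great_sphere p C & range y `<=` C]].
Proof.
move=> n0 lL dimE mx.
have [e [D [fe spanE]]] := exists_eigenframe n0 dimE.
have [P [eta [uP eP DP eta_inj eta2]]] := frame_fourier lL fe.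
have fP : fourier_matrix e D P eta by [].
have [A xA] := spanE _ x mx.
have xE : x = fun u => e u *m A by apply/funext.
have gA : gram_condition e D (A *m A^T) by apply/(gram_conditionP _ n0 fe); rewrite -xE.
have [|a [a0 aE]] := @isometric_weights R n _ _ e D P eta A (metric_coef R n) fP eta_inj.
  by move=> u i j; rewrite gram_dot (gA.2 u i j).
have [b [b0 bE bs]] := few_weights a0 aE.
have gB := wave_gram_condition n0 fP eta2 b0 bE.
set B := wave_matrix P b in gB.
have [K [Q [s [t [st0 QQ AE AA BB]]]]] := gram_path A B.
(* Interpolating the weights under the square root makes the Gram matrix follow the segment. The
   path starts at [A] exactly; at the end only the Gram matrix of [B] is reached, which suffices for
   homogeneity and for the rank. *)
pose path (r : R) := K *m diag_mx (map_mx Num.sqrt ((1 - r) *: s + r *: t)) *m Q.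
have path_gram r : 0 <= r <= 1 ->
    path r *m (path r)^T = (1 - r) *: (A *m A^T) + r *: (B *m B^T).
  move=> /andP[r0 r1]; rewrite /path [(_ *m Q)^T]trmx_mul !mulmxA.
  rewrite -[K *m _ *m Q *m Q^T]mulmxA QQ mulmx1 trmx_mul tr_diag_mx mulmxA.
  rewrite -[K *m diag_mx _ *m diag_mx _]mulmxA mulmx_diag AA BB.
  rewrite (_ : diag_mx _ = (1 - r) *: diag_mx s + r *: diag_mx t).
    by rewrite mulmxDr mulmxDl -!scalemxAr -!scalemxAl.
  rewrite -!linearZ -linearD /=.
  congr diag_mx; apply/rowP => k; rewrite !mxE -expr2 sqr_sqrtr //.
  by have [s0 t0] := st0 k; rewrite addr_ge0 // mulr_ge0 // subr_ge0.
have path0 : path 0 = A by rewrite /path subr0 scale1r scale0r addr0 -AE.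
have path1 : path 1 *m (path 1)^T = B *m B^T.
  by rewrite path_gram ?ler01 ?lexx // subrr scale0r add0r scale1r.
have mP r : 0 <= r <= 1 -> minimal_isometric_immersion L (fun u => e u *m path r).
  move=> r01; apply/(gram_conditionP _ n0 fe); rewrite path_gram //.
  exact: gram_condition_convex.
have m1 : minimal_isometric_immersion L (fun u => e u *m path 1).
  by apply: mP; rewrite ler01 lexx.
exists (fun r u => e u *m path r), (fun u => e u *m path 1); split.
- split=> //; last by rewrite xE path0.
  by apply: continuous_subspaceT; apply: continuous_path; case: fe.
- exact: (wave_homogeneous fe fP b0 path1).
have y1 u : sphere (e u *m path 1) by case: m1.
have nz : path 1 != 0.
  apply/eqP => p0; have := y1 0; rewrite /sphere /= p0 mulmx0 dotE mul0mx mxE.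
  by move/eqP; rewrite eq_sym oner_eq0.
have [C [gC CE]] := row_space_great_sphere nz.
exists (\rank (path 1)).-1, C; split=> //.
  (* The rank, which is [p + 1], is at most the number of columns of [B], twice the number of
     nonzero weights. *)
  rewrite prednK ?lt0n ?mxrank_eq0 // (leq_trans (rank_gram_le path1)) //.
  by rewrite (leq_trans (rank_leq_col _)) // addnn -mul2n.
by move=> _ [u _ <-]; apply: CE => //; exact: submxMl.
Qed.
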